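(* Let $n\geqslant 2$ be an integer, let $\mu\in\mathbb{R}\smallsetminus\mathbb{Q}$, and let $\Gamma_A\subset\mathrm{Aff}(\mathbb{R})$ be the subgroup generated by $x\mapsto x+1$, $x\mapsto nx$ and $x\mapsto\mu x$. Let $\alpha>0$, and let $\phi\colon\Gamma_A\to\mathrm{Diff}^{1+\alpha}([0,1])$ be an action which is $C^0$-conjugate to the standard affine action, i.e. there exists a homeomorphism $f\colon(0,1)\to\mathbb{R}$ such that for every $\gamma\in\Gamma_A$ we have $f\circ\phi(\gamma)=\gamma\circ f$ on $(0,1)$. Then $f$ is of class $C^{1+\alpha}$. The same holds if the regularity $1+\alpha$ is replaced (in both hypothesis and conclusion) by $r+\omega$, where $r\geqslant 1$ is an integer and $\omega\colon[0,+\infty)\to[0,+\infty)$ is a homeomorphism for which there exists an increasing map $\nu\colon[0,+\infty)\to[0,+\infty)$ sending $(0,1)$ into $(0,1)$ such that $\omega(tx)\leqslant\nu(t)\omega(x)$ for all $x\in[0,1]$ and $t\in[0,+\infty)$.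
   Context: A map is of class $C^\alpha$ ($\alpha\geqslant 1$ real) if it is $C^{\lfloor\alpha\rfloor}$ and its $\lfloor\alpha\rfloor$-derivatives are $(\alpha-\lfloor\alpha\rfloor)$-Hölder. For a homeomorphism $\omega\colon[0,+\infty)\to[0,+\infty)$, a real function $g$ is $\omega$-continuous if for some $C>0$, $|g(x)-g(y)|\leqslant C\,\omega(|x-y|)$ for all $x,y$; a map $f$ is of class $C^{r+\omega}$ if it is $C^r$ and $f^{(r)}$ is $\omega$-continuous. On open intervals these conditions are understood locally. $\mathrm{Diff}^{1+\alpha}([0,1])$ (resp. $\mathrm{Diff}^{r+\omega}([0,1])$) is the group of diffeomorphisms of $[0,1]$ of the given class. An action means a group homomorphism. *)

(* Defs.v *)
From HB Require Import structures.
From mathcomp Require Import all_boot all_order all_algebra.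
From mathcomp Require Import all_classical all_reals all_analysis.

Set Implicit Arguments.
Unset Strict Implicit.
Unset Printing Implicit Defensive.

Import Order.TTheory GRing.Theory Num.Theory.
Import numFieldNormedType.Exports.

Local Open Scope classical_set_scope.
Local Open Scope ring_scope.

(* Maps defined on a subset D of R are represented by total functions whose
   values outside D are irrelevant. *)

Definition homeomorphism {T U : topologicalType} (A : set T) (B : set U)
    (f : T -> U) : Prop :=
  [/\ set_bij A B f, {within A, continuous f} &
      exists g : U -> T, [/\ set_fun B A g, {in A, cancel f g},
                             {in B, cancel g f} & {within B, continuous g}]].

Section Regularity.
Variable R : realType.
Implicit Types (D : set R) (f g omega : R -> R).

Definition diff_quot f (x y : R) : R := (f y - f x) / (y - x).

(* Derivative relative to D: the limit is taken along y in D, y != x. Thus it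
   is one-sided at the endpoints of [0, 1], and is the usual derivative on an
   open set (derive1_in_open below). *)
Definition derivable1_in D f (x : R) : Prop :=
  cvg (diff_quot f x @ within D x^').

Definition derive1_in D f (x : R) : R := lim (diff_quot f x @ within D x^').

Definition derive1n_in D (k : nat) f : R -> R := iter k (derive1_in D) f.

Definition is_C D (r : nat) f : Prop :=
  (forall k x, (k < r)%N -> D x -> derivable1_in D (derive1n_in D k f) x) /\
  {within D, continuous (derive1n_in D r f)}.

Definition omega_continuous omega D g : Prop :=
  exists2 C : R, 0 < C &
    forall x y, D x -> D y -> `|g x - g y| <= C * omega `|x - y|.

Definition locally_omega_continuous omega D g : Prop :=
  forall x, D x -> exists2 U, nbhs x U & omega_continuous omega (D `&` U) g.

Definition is_C_omega D (r : nat) omega f : Prop :=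
  is_C D r f /\ omega_continuous omega D (derive1n_in D r f).

Definition is_C_omega_loc D (r : nat) omega f : Prop :=
  is_C D r f /\ locally_omega_continuous omega D (derive1n_in D r f).

(* C^a is C^(r + omega) with r the integer part of a and omega t = t^(a - r).
   For integer a this modulus is constantly 1 (0 `^ 0 = 1), so that 0-Hölder
   means bounded. *)
Definition holder_modulus (a t : R) : R := t `^ (a - (Num.truncn a)%:R).

Definition is_C_real D (a : R) f : Prop :=
  is_C_omega D (Num.truncn a) (holder_modulus a) f.

Definition is_C_real_loc D (a : R) f : Prop :=
  is_C_omega_loc D (Num.truncn a) (holder_modulus a) f.

(* Diffeomorphisms of [0, 1] of a class P; they may reverse orientation. *)
Definition Diff01 (P : set (R -> R)) : set (R -> R) :=
  [set g | set_bij `[0, 1] `[0, 1] g /\ P g /\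
    exists h : R -> R, [/\ set_fun `[0, 1] `[0, 1] h, {in `[0, 1], cancel g h},
                  {in `[0, 1], cancel h g} & P h]].

End Regularity.

Section Affine.
Variable R : realType.

Definition Aff : set (R -> R) :=
  [set g | exists a b : R, a != 0 /\ g = (fun x => a * x + b)].

Definition Aff_subgroup (H : set (R -> R)) : Prop :=
  [/\ H `<=` Aff, H id, forall g h, H g -> H h -> H (g \o h) &
      forall g h, H g -> cancel g h -> cancel h g -> H h].

Definition Gamma_A (n : nat) (mu : R) : set (R -> R) :=
  smallest Aff_subgroup
    [set (fun x => x + 1); (fun x => n%:R * x); (fun x => mu * x)].

(* Group homomorphisms from G (a group of maps under composition) to the group
   of diffeomorphisms of [0, 1] of class P. *)
Definition is_action (G P : set (R -> R)) (phi : (R -> R) -> R -> R) : Prop :=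
  (forall g, G g -> Diff01 P (phi g)) /\
  (forall g h, G g -> G h ->
     forall x, x \in `[0, 1] -> phi (g \o h) x = phi g (phi h x)).

Definition conjugates_to_standard (G : set (R -> R))
    (phi : (R -> R) -> R -> R) (f : R -> R) : Prop :=
  homeomorphism (`]0, 1[ : set R) [set: R] f /\
  forall g, G g -> forall x, x \in `]0, 1[ -> f (phi g x) = g (f x).

(* "Increasing" is taken in the weak sense. This is no loss: from a
   nondecreasing nu one gets a strictly increasing one, t + (1 - t) * nu t for
   t < 1 and t + nu t for 1 <= t, with the same properties. *)
Definition admissible_modulus (omega : R -> R) : Prop :=
  homeomorphism (`[0, +oo[ : set R) (`[0, +oo[ : set R) omega /\
  exists nu : R -> R,
    [/\ set_fun `[0, +oo[ `[0, +oo[ nu,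
        {in `[0, +oo[ &, {homo nu : s t / s <= t}},
        set_fun `]0, 1[ `]0, 1[ nu &
        forall x t, x \in `[0, 1] -> 0 <= t ->
          omega (t * x) <= nu t * omega x].

End Affine.

Lemma derive1_in_open (R : realType) (D : set R) (f : R -> R) (x : R) :
  open D -> D x ->
  (derivable1_in D f x <-> derivable f x 1) /\ derive1_in D f x = f^`()%classic x.
Proof.
move=> oD Dx.
have E : diff_quot f x @ within D x^' =
         (fun h => h^-1 *: (f (h *: 1 + x) - f x)) @ (0 : R)^'.
  have nD : \forall y \near x, D y by exact: open_nbhs_nbhs.
  apply/predeqP => P; split => HP.
    have {}HP : \forall y \near x, D y -> y != x -> P (diff_quot f x y).
      by move: HP; apply: (@filterS R (nbhs x)) => y /= HPy Dy yx; exact: HPy.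
    have : \forall y \near x, y != x -> P (diff_quot f x y).
      by move: nD HP; apply: filterS2 => y Dy + yx; exact.
    move/nbhs0P; apply: (@filterS R (nbhs (0 : R))) => h /= + h0.
    rewrite /diff_quot [x + h]addrC addrK [h *: 1]mulr1 /GRing.scale /= mulrC; apply.
    by rewrite -subr_eq0 addrK.
  suff : \forall y \near x, y != x -> P (diff_quot f x y).
    by apply: (@filterS R (nbhs x)) => y /= HPy yx Dy; exact: HPy.
  apply/nbhs0P; move: HP; apply: (@filterS R (nbhs (0 : R))) => h /= + h0.
  rewrite /diff_quot [x + h]addrC addrK [h *: 1]mulr1 /GRing.scale /= mulrC; apply.
  by apply: contraNN h0 => /eqP ->; rewrite addr0.
rewrite /derivable1_in /derive1_in derive1E E; split => //.
Qed.

(* Main.v *)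
Require Import Defs.
From mathcomp Require Import all_boot all_order all_algebra.
From mathcomp Require Import all_classical all_reals all_analysis.
From mathcomp Require Import ring lra.

Set Implicit Arguments.
Unset Strict Implicit.
Unset Printing Implicit Defensive.

Import Order.TTheory GRing.Theory Num.Theory.
Import numFieldNormedType.Exports.

Local Open Scope classical_set_scope.
Local Open Scope ring_scope.

(** Write [e] for the inverse of the conjugacy [f] and [E a t] for the diffeomorphism
    with [E a t (e s) = e (a * s + t)], where [a] is a power of [n] and [t] is an
    [n]-adic rational. Replacing [f] by [- f] makes [e] increasing. The argument has four
    steps.

    Multipliers ([multiplier], [dE_homothety]). Every contraction [E (n ^- i) t] has
    derivative exactly [n ^- i] at its interior fixed point. Let [T] be the unit
    translation, [B] such a contraction with fixed point [e 0] and multiplier [lam],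
    [m = n ^ i], and [rho] the derivative of [B^-1] at the endpoint [1]. As [T] is
    conjugate to its own power [T ^ m], its derivative at [1] is [1], so consecutive
    intervals [[e s, e (s + 1)]] have asymptotically equal lengths as [s] grows. Since
    [B^-1] maps the interval at [s] onto [m] consecutive ones at [m * s], the length at
    [m ^ k] is multiplied by about [rho / m] from [k] to [k + 1]. But that interval is
    also the image, under [B ^ k], then a translation, then [B ^- k], of the fixed
    interval [[e 0, e 1]], so its length grows at the rate [lam * rho]. Hence
    [lam = 1 / m].

    Straightening ([potential], [dT_local], [f_C1_origin]). Let [G = E (1 / n) 0] and
    [p = e 0]. As [G' p = 1 / n] and [G'] converges geometrically along orbits to its
    value at [p], the series [psi x = \sum_j ln (n * G' (G ^ j x))] converges near [p],
    and [expR psi] is the length element for which [G] is an exact contraction by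
    [1 / n]. The multipliers of the contractions [E (n ^- k) t], as [k] tends to infinity,
    say that [E 1 t] preserves this length element at [p]; by the chain rule and the
    density of [n]-adic rationals it preserves it near [p]. A primitive of [expR psi] is
    then additive under a dense set of translations in the coordinate [f], so it is an
    affine function of [f], and [f] is [C^1] near [p] with derivative a multiple of
    [expR psi].

    Bootstrap ([bootstrap]). The derivative satisfies [f' x = n * G' x * f' (G x)]. A
    continuous solution of [w = b + a * (w \o G)] near the attracting fixed point [p] is
    as regular as [a], [b] and [G'], provided that the products of [a] along orbits are
    bounded: formal differentiation gives an equation of the same kind with [a]
    replaced by [a * G'], and the contraction makes the remainders summable. The
    identity [f = n * (f \o G)] carries the regularity from [p] to all of [(0, 1)].

    Moduli. The classes [C^(r + omega)] are stable under products and composition only if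
    [t] is at most a multiple of [omega t] on [[0, 1]]. Otherwise [omega]-continuous maps
    are constant ([flat_modulus_constant]), the elements [E 1 j] would be polynomials of
    bounded degree, and the vanishing of their finite differences contradicts their
    dynamics ([translations_not_poly_like]). *)

(** * Germs of regularity *)

Section Calculus.
Context {R : realType}.
Implicit Types (f g h w : R -> R) (x y z : R).

Lemma is_derive_continuous g x c : is_derive x 1 g c -> {for x, continuous g}.
Proof. by case=> dg _; apply/differentiable_continuous/derivable1_diffP. Qed.

Lemma MVT_between g (g' : R -> R) y z :
  (forall c, Num.min y z <= c <= Num.max y z -> is_derive c 1 g (g' c)) ->
  exists2 c, Num.min y z <= c <= Num.max y z & g z - g y = g' c * (z - y).
Proof.
wlog yz : y z / y <= z.
  move=> H dg; have /orP[yz|zy] := le_total y z; first exact: H.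
  have [c|c] := H z y zy; first by rewrite minC maxC; exact: dg.
  rewrite minC maxC => cyz E; exists c => //.
  by rewrite -opprB E -mulrN opprB.
rewrite min_l// max_r// => dg.
have [||c] := @MVT_segment R g g' y z yz.
- by move=> c; rewrite in_itv/= => /andP[/ltW ? /ltW ?]; apply: dg; apply/andP.
- apply: derivable_within_continuous => c; rewrite in_itv/= => cyz.
  by case: (dg _ cyz).
by rewrite in_itv/= => cyz E; exists c.
Qed.

Lemma MVT_ball g (g' : R -> R) x d y z :
  (forall c, `|c - x| < d -> is_derive c 1 g (g' c)) ->
  `|y - x| < d -> `|z - x| < d ->
  exists c, [/\ `|c - x| < d, Num.min y z <= c <= Num.max y z,
     `|c - y| <= `|z - y| & g z - g y = g' c * (z - y)].
Proof.
move=> dg yd zd.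
have H c : Num.min y z <= c <= Num.max y z -> `|c - x| < d.
  by move: yd zd; rewrite !ltr_norml; case: (leP y z) => _; lra.
have [c /H/dg//|c cyz E] := @MVT_between g g' y z.
exists c; split => //; first exact: H.
move: cyz; case: (leP y z) => yz cyz.
  by rewrite !ger0_norm; lra.
by rewrite !ler0_norm; lra.
Qed.

Lemma nearP (P : set R) x :
  (\forall y \near x, P y) <-> exists2 d, 0 < d & forall y, `|y - x| < d -> P y.
Proof.
split=> [/nbhs_normP[d /= d0 H]|[d d0 H]].
  by exists d => // y yd; apply: H; rewrite /ball_/= distrC.
by apply/nbhs_normP; exists d => //= y; rewrite /ball_/= distrC; exact: H.
Qed.

Lemma near_all (P : set R) x : (forall y, P y) -> \forall y \near x, P y.
Proof. by move=> HP; apply: filterE. Qed.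

Lemma ball_trans x y p (d : R) : `|y - x| < d - `|x - p| -> `|y - p| < d.
Proof. by rewrite ltrBrDr; exact/le_lt_trans/ler_distD. Qed.

Lemma ball_segment x p (d : R) : (`|x - p| <= d) = (p - d <= x <= p + d).
Proof. exact: ler_distl. Qed.

Lemma near2P (P : set (R * R)) x :
  (\forall yz \near (x, x), P yz) <->
  exists2 d, 0 < d & forall y z, `|y - x| < d -> `|z - x| < d -> P (y, z).
Proof.
split=> [[[A B]] /= [/nearP[a a0 Aa] /nearP[b b0 Bb] H]|[d d0 H]].
  exists (Num.min a b); first by rewrite lt_min a0.
  move=> y z; rewrite !lt_min => /andP[ya _] /andP[_ zb].
  by apply: H; split; [exact: Aa|exact: Bb].
exists ([set y | `|y - x| < d], [set y | `|y - x| < d]) => /=.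
  by split; apply/nearP; exists d.
by move=> [y z] [/=]; exact: H.
Qed.

Lemma near2_diag (P : set R) x : (\forall y \near x, P y) ->
  \forall yz \near (x, x), P yz.1 /\ P yz.2.
Proof. by move=> Px; exists (P, P) => //= -[]. Qed.

Lemma continuous_distP g x : {for x, continuous g} <->
  forall eps, 0 < eps -> exists2 d, 0 < d &
    forall y, `|y - x| < d -> `|g y - g x| < eps.
Proof.
split=> [cg eps e0|H].
  move/cvgrPdist_lt/(_ _ e0)/nearP : cg => [d d0 H].
  by exists d => // y /H; rewrite distrC.
apply/cvgrPdist_lt => eps /H[d d0 {}H]; apply/nearP; exists d => // y /H.
by rewrite distrC.
Qed.

Lemma seq_limP (u : nat -> R) l : u @ \oo --> l <->
  forall eps, 0 < eps -> exists N, forall k, (N <= k)%N -> `|u k - l| < eps.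
Proof.
split=> [ul eps e0|H].
  move/cvgrPdist_lt/(_ _ e0) : ul => [N _ H].
  by exists N => k /H; rewrite distrC.
apply/cvgrPdist_lt => eps /H[N {}H]; exists N => // k /H.
by rewrite distrC.
Qed.

Lemma continuous_bounded g x : {for x, continuous g} ->
  \forall y \near x, `|g y| <= `|g x| + 1.
Proof.
move=> /cvgrPdist_le/(_ 1 ltr01); apply: filterS => y.
by have := ler_normD (g y - g x) (g x); rewrite subrK distrC; lra.
Qed.

End Calculus.

Section GermRegularity.
Context {R : realType}.
Implicit Types (f g h w om nu : R -> R) (x y z : R).

Definition om_near om g x := exists2 C, 0 <= C &
  \forall yz \near (x, x), `|g yz.1 - g yz.2| <= C * om `|yz.1 - yz.2|.

(** Membership of the germ of [g] at [x] in [C^(s + om)], with derivatives given by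
    witnesses. Continuity is required besides the modulus because the modulus may be
    the constant [1], for which [om_near] only means boundedness. *)
Fixpoint Reg om (s : nat) g x : Prop := match s with
  | 0 => (\forall y \near x, {for y, continuous g}) /\ om_near om g x
  | s'.+1 => exists2 g' : R -> R, (\forall y \near x, is_derive (y : R) 1 g (g' y))
                                & Reg om s' g' x
  end.

(** [om_nu] controls [om] under rescaling, which composition needs; [om_lin] makes
    Lipschitz maps [om]-continuous, so that the classes decrease with the order. *)
Record modulus om nu : Prop := Modulus {
  om_ge0 : forall t, 0 <= t -> 0 <= om t ;
  nu_ge0 : forall t, 0 <= t -> 0 <= nu t ;
  nu_mono : forall s t, 0 <= s -> s <= t -> nu s <= nu t ;
  om_nu : forall x t, 0 <= x <= 1 -> 0 <= t -> om (t * x) <= nu t * om x ;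
  om_lin : exists2 C, 0 <= C & forall t, 0 <= t <= 1 -> t <= C * om t }.

Lemma Reg_continuous om s g x : Reg om s g x ->
  \forall y \near x, {for y, continuous g}.
Proof.
case: s => [[]//|s [g' dg _]]; apply: filterS dg => y; exact: is_derive_continuous.
Qed.

Lemma om_near_near om g x : om_near om g x -> \forall y \near x, om_near om g y.
Proof.
move=> [C C0 /near2P[d d0 H]]; apply/nearP; exists (d / 2); first by lra.
move=> y yd; exists C => //; apply/near2P; exists (d / 2); first by lra.
move=> u v ud vd; have := ler_distD y u x; have := ler_distD y v x.
by move=> ? ?; apply: H; lra.
Qed.

Lemma Reg_near om s g x : Reg om s g x -> \forall y \near x, Reg om s g y.
Proof.
elim: s g => [g [cg /om_near_near og]|s IH g [g' dg /IH rg]] /=.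
  by apply: filterS2 (near_join cg) og.
apply: filterS2 (near_join dg) rg => y dgy rgy; by exists g'.
Qed.

Lemma Reg_eq om s g h x : (\forall y \near x, g y = h y) ->
  Reg om s g x -> Reg om s h x.
Proof.
elim: s g h => [|s IH] g h gh /=.
  move=> [cg [C C0 og]]; split.
    apply: filterS2 (near_join gh) cg => y ghy cgy.
    have ghy0 := nbhs_singleton ghy.
    rewrite /prop_for /continuous_at -ghy0; apply: cvg_trans cgy.
    by apply: near_eq_cvg; apply: filterS ghy => z /= ->.
  exists C => //; apply: filterS2 (near2_diag gh) og => -[y z] /= [-> ->] //.
move=> [g' dg rg]; exists g' => //.
apply: filterS2 (near_join gh) dg => y ghy dgy.
by apply: near_eq_is_derive dgy.
Qed.

Variables om nu : R -> R.
Hypothesis mo : modulus om nu.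

Lemma om_near_dom g h x : om_near om g x -> (exists2 L, 0 <= L &
    \forall yz \near (x, x), `|h yz.1 - h yz.2| <= L * `|g yz.1 - g yz.2|) ->
  om_near om h x.
Proof.
move=> [C C0 og] [L L0 H]; exists (L * C); first exact: mulr_ge0.
apply: filterS2 og H => -[y z] /= H1 H2; apply: (le_trans H2).
by rewrite -mulrA ler_wpM2l.
Qed.

Lemma om_near_lip h x : (exists2 L, 0 <= L &
    \forall yz \near (x, x), `|h yz.1 - h yz.2| <= L * `|yz.1 - yz.2|) ->
  om_near om h x.
Proof.
apply: (@om_near_dom id); have [C C0 H] := om_lin mo.
exists C => //; apply/near2P; exists (2^-1) => // y z yx zx /=.
apply: H; have := ler_distD x y z; rewrite (distrC x z) normr_ge0 /=; lra.
Qed.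

Lemma C1_lip g g' x : (\forall y \near x, is_derive (y : R) 1 g (g' y)) ->
  {for x, continuous g'} -> exists2 L, 0 <= L &
    \forall yz \near (x, x), `|g yz.1 - g yz.2| <= L * `|yz.1 - yz.2|.
Proof.
move=> dg /continuous_bounded bg; exists (`|g' x| + 1); first by have := normr_ge0 (g' x); lra.
have [d d0 H] := (nearP _ _).1 (filterI dg bg).
apply/near2P; exists d => // y z yd zd /=.
have [c /H[]//|c [cd _ _ E]] := @MVT_ball R g g' x d z y _ zd yd.
by rewrite E normrM ler_wpM2r//; case: (H _ cd).
Qed.

Lemma Reg_lip s g x : Reg om s.+1 g x -> exists2 L, 0 <= L &
    \forall yz \near (x, x), `|g yz.1 - g yz.2| <= L * `|yz.1 - yz.2|.
Proof.
by move=> [g' dg /Reg_continuous/nbhs_singleton cg']; exact: C1_lip dg cg'.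
Qed.

Lemma RegS s g x : Reg om s.+1 g x -> Reg om s g x.
Proof.
elim: s g => [|s IH] g.
  move=> rg; split; first exact: Reg_continuous rg.
  by apply: om_near_lip; apply: Reg_lip rg.
by move=> [g' dg /IH rg]; exists g'.
Qed.

Lemma Reg_le s t g x : (s <= t)%N -> Reg om t g x -> Reg om s g x.
Proof.
move=> /subnKC <-; elim: (t - s)%N => [|k IH]; first by rewrite addn0.
by rewrite addnS => /RegS.
Qed.

Lemma Reg_cst s c x : Reg om s (cst c) x.
Proof.
elim: s c => [|s IH] c /=.
  split; first by apply: near_all => y; exact: cvg_cst.
  apply: om_near_lip; exists 0 => //; apply/near2P; exists 1 => // y z _ _ /=.
  by rewrite subrr normr0 mul0r.
exists (cst 0) => //; apply: near_all => y; exact: is_derive_cst.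
Qed.

Lemma RegD s g h x : Reg om s g x -> Reg om s h x ->
  Reg om s (fun y => g y + h y) x.
Proof.
elim: s g h => [|s IH] g h /=.
  move=> [cg [C C0 og]] [ch [D D0 oh]]; split.
    by apply: filterS2 cg ch => y ? ?; exact: continuousD.
  exists (C + D); first exact: addr_ge0.
  apply: filterS2 og oh => -[y z] /= H1 H2.
  rewrite mulrDl; apply: le_trans (lerD H1 H2).
  have -> : g y + h y - (g z + h z) = (g y - g z) + (h y - h z) by ring.
  exact: ler_normD.
move=> [g' dg rg] [h' dh rh]; exists (fun y => g' y + h' y); last exact: IH.
by apply: filterS2 dg dh => y ? ?; exact: is_deriveD.
Qed.

Lemma RegM s g h x : Reg om s g x -> Reg om s h x ->
  Reg om s (fun y => g y * h y) x.
Proof.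
elim: s g h => [|s IH] g h.
  move=> [cg [C C0 og]] [ch [D D0 oh]]; split.
    by apply: filterS2 cg ch => y ? ?; exact: continuousM.
  have bg := near2_diag (continuous_bounded (nbhs_singleton cg)).
  have bh := near2_diag (continuous_bounded (nbhs_singleton ch)).
  exists ((`|h x| + 1) * C + (`|g x| + 1) * D).
    by rewrite addr_ge0// mulr_ge0// addr_ge0.
  apply: filterS2 (filterI og oh) (filterI bg bh) => -[y z] /= [H1 H2] [[G1 G2] [H3 H4]].
  have -> : g y * h y - g z * h z = (g y - g z) * h y + g z * (h y - h z) by ring.
  rewrite [leRHS]mulrDl; apply: (le_trans (ler_normD _ _)); rewrite !normrM.
  apply: lerD; last by rewrite -mulrA ler_pM.
  by rewrite mulrC -mulrA ler_pM.
move=> rg rh; have rg1 := RegS rg; have rh1 := RegS rh.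
case: rg => g' dg rg; case: rh => h' dh rh.
exists (fun y => g y * h' y + h y * g' y); last by apply: RegD; apply: IH.
by apply: filterS2 dg dh => y ? ?; exact: is_deriveM.
Qed.

Lemma near_comp g x (P : set R) : {for x, continuous g} ->
  (\forall y \near g x, P y) -> \forall y \near x, P (g y).
Proof. by move=> cg Pg; exact: cg Pg. Qed.

(** Only [C^1] regularity of the inner map is used at order [0], since a Lipschitz map
    distorts the modulus by a bounded factor. *)
Lemma Reg_comp s w g x : Reg om s w (g x) -> Reg om (maxn s 1) g x ->
  Reg om s (fun y => w (g y)) x.
Proof.
have nu0 t : 0 <= t -> 0 <= nu t by exact: (nu_ge0 mo).
have omnu z t : 0 <= z <= 1 -> 0 <= t -> om (t * z) <= nu t * om z by exact: (om_nu mo).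
elim: s w g => [|s IH] w g.
  move=> [cw [C C0 ow]] rg.
  have cg := Reg_continuous rg; have [L L0 lg] := Reg_lip rg.
  have cgx := nbhs_singleton cg; split.
    apply: filterS2 cg (near_comp cgx cw) => y cgy cwy; exact: continuous_comp.
  exists (C * nu L); first by rewrite mulr_ge0// nu0.
  have : \forall yz \near (x, x), `|yz.1 - yz.2| <= 1.
    apply/near2P; exists (2^-1) => // y z yx zx /=.
    by have := ler_distD x y z; rewrite (distrC x z); lra.
  have : \forall yz \near (x, x), `|w (g yz.1) - w (g yz.2)| <= C * om `|g yz.1 - g yz.2|.
    have /near2P[d d0 H] := ow.
    have /near2_diag : \forall y \near x, `|g y - g x| < d.
      apply: (near_comp (P := fun t => `|t - g x| < d) cgx).
      by apply/nearP; exists d.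
    by apply: filterS => -[y z] /= [? ?]; exact: H.
  move=> H1 H2; apply: filterS2 (filterI H1 H2) lg => -[y z] /= [{}H1 {}H2] H3.
  have [->|yz] := eqVneq y z; first by rewrite !subrr normr0 !mulr_ge0 ?nu0 ?(om_ge0 mo).
  apply: (le_trans H1); rewrite -mulrA ler_wpM2l//.
  have yz0 : 0 < `|y - z| by rewrite normr_gt0 subr_eq0.
  have {1}-> : `|g y - g z| = (`|g y - g z| / `|y - z|) * `|y - z|.
    by rewrite divfK ?gt_eqF.
  apply: (le_trans (omnu _ _ _ _)); first by rewrite ltW.
    by rewrite divr_ge0.
  rewrite ler_wpM2r ?(om_ge0 mo)// (nu_mono mo) ?divr_ge0//.
  by rewrite ler_pdivrMr.
have -> : maxn s.+1 1 = s.+1 by rewrite (maxn_idPl _).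
move=> rw rg; have rg1 := RegS rg; have rgc := Reg_continuous rg.
have [g' dg rg'] := rg; have [w' dw rw'] := rw.
exists (fun y => w' (g y) * g' y).
  apply: filterS2 dg (near_comp (nbhs_singleton rgc) dw) => y dgy dwy.
  exact: (@is_derive1_comp R w g).
by apply: RegM => //; apply: IH => //; apply: Reg_le rg; rewrite geq_max leqnSn.
Qed.

Lemma RegZ s c g x : Reg om s g x -> Reg om s (fun y => c * g y) x.
Proof. by move=> rg; apply: RegM => //; exact: Reg_cst. Qed.

End GermRegularity.

(** * Strict derivatives and growth rates of sequences *)

Section StrictDerivative.
Context {R : realType}.
Implicit Types (g h : R -> R) (x y : R) (u v : nat -> R).

(** The points [u] and [v] vary independently, which is what slopes between two moving
    points require. They stay in [(0, 1)], so that [x = 1] gives the one-sided notion at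
    that endpoint. *)
Definition strict_deriv g x (c : R) := forall eps : R, 0 < eps ->
  exists2 d : R, 0 < d & forall u v : R, 0 < u < 1 -> 0 < v < 1 -> `|u - x| < d -> `|v - x| < d ->
  `|g v - g u - c * (v - u)| <= eps * `|v - u|.

Lemma seq_lim_unique u (a b : R) : u @ \oo --> a -> u @ \oo --> b -> a = b.
Proof. by move=> ua ub; apply: (@norm_cvg_unique _ _ (u @ \oo)). Qed.

Lemma seq_limM u v (a b : R) : u @ \oo --> a -> v @ \oo --> b ->
  (fun k => u k * v k) @ \oo --> a * b.
Proof. by move=> ? ?; exact: cvgM. Qed.

Lemma seq_limV u (a : R) : a != 0 -> u @ \oo --> a ->
  (fun k => (u k)^-1) @ \oo --> a^-1.
Proof. by move=> ? ?; exact: cvgV. Qed.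

Lemma seq_lim_sum m (u : nat -> nat -> R) (a : nat -> R) :
  (forall i, u i @ \oo --> a i) ->
  (fun k => \sum_(i < m) u i k) @ \oo --> \sum_(i < m) a i.
Proof.
move=> H; elim: m => [|m IH].
  by rewrite big_ord0; under eq_fun do rewrite big_ord0; exact: cvg_cst.
rewrite big_ord_recr /=; under eq_fun do rewrite big_ord_recr /=.
by apply: cvgD.
Qed.

Lemma strict_deriv_slope g x c u v : strict_deriv g x c ->
  (forall k, 0 < u k < 1) -> (forall k, 0 < v k < 1) ->
  (forall k, u k != v k) -> u @ \oo --> x -> v @ \oo --> x ->
  (fun k => (g (v k) - g (u k)) / (v k - u k)) @ \oo --> c.
Proof.
move=> sg u01 v01 uv /seq_limP ux /seq_limP vx; apply/seq_limP => eps eps0.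
have [|d d0 H] := sg (eps / 2); first by lra.
have [N Hu] := ux _ d0; have [M Hv] := vx _ d0.
exists (maxn N M) => k; rewrite geq_max => /andP[Nk Mk].
have vu : v k - u k != 0 by rewrite subr_eq0 eq_sym.
have -> : (g (v k) - g (u k)) / (v k - u k) - c =
  (g (v k) - g (u k) - c * (v k - u k)) / (v k - u k) by field.
apply: (@le_lt_trans _ _ (eps / 2)); last by lra.
rewrite normrM normfV ler_pdivrMr ?normr_gt0//.
by apply: H; rewrite // ?Hu ?Hv.
Qed.

Lemma C1_strict_deriv g (g' : R -> R) x :
  (\forall y \near x, is_derive (y : R) 1 g (g' y)) -> {for x, continuous g'} ->
  strict_deriv g x (g' x).
Proof.
move=> dg cg eps eps0.
have /continuous_distP/(_ _ eps0)[d1 d10 H1] := cg.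
have /nearP[d2 d20 H2] := dg.
exists (Num.min d1 d2) => [|u v _ _]; first by rewrite lt_min d10.
move=> ux vx.
have [c|c [cd cuv _ ->]] := @MVT_ball R g g' x (Num.min d1 d2) u v _ ux vx.
  by rewrite lt_min => /andP[_]; exact: H2.
rewrite -mulrBl normrM ler_wpM2r// ltW// H1//.
by move: cd; rewrite lt_min => /andP[].
Qed.

(** The slopes of inverse maps multiply to [1]; the sequences supply the pairs of points
    at which the slopes are taken. *)
Lemma strict_deriv_inv g h x y c d u v : strict_deriv g x c -> strict_deriv h y d ->
  (forall k, 0 < u k < 1) -> (forall k, 0 < v k < 1) ->
  (forall k, 0 < g (u k) < 1) -> (forall k, 0 < g (v k) < 1) ->
  (forall k, u k != v k) -> (forall k, h (g (u k)) = u k) -> (forall k, h (g (v k)) = v k) ->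
  u @ \oo --> x -> v @ \oo --> x ->
  (fun k => g (u k)) @ \oo --> y -> (fun k => g (v k)) @ \oo --> y -> c * d = 1.
Proof.
move=> sg sh u01 v01 gu01 gv01 uv hu hv ux vx guy gvy.
have guv k : g (u k) != g (v k).
  by apply: contra_neq (uv k) => E; rewrite -hu E hv.
have H := seq_limM (strict_deriv_slope sg u01 v01 uv ux vx)
               (strict_deriv_slope sh gu01 gv01 guv guy gvy).
apply: (seq_lim_unique H); apply/seq_limP => eps e0; exists 0%N => k _ /=.
rewrite !hu !hv.
have -> : (g (v k) - g (u k)) / (v k - u k) * ((v k - u k) / (g (v k) - g (u k))) = 1.
  field; rewrite !subr_eq0; apply/andP.
  by split; rewrite eq_sym.
by rewrite subrr normr0.
Qed.

(** The ratio of consecutive terms dominates the growth rate: otherwise the terms would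
    eventually outgrow [r ^+ k]. *)
Lemma ratio_le_root (q : nat -> R) (L r : R) : (forall k, 0 < q k) -> 0 < r ->
  (fun k => q k.+1 / q k) @ \oo --> L -> (forall k, q k <= r ^+ k) -> L <= r.
Proof.
move=> q0 r0 qL qr; rewrite leNgt; apply/negP => rL.
pose t := (r + L) / 2; have tL : t < L by rewrite /t; lra.
have rt : r < t by rewrite /t; lra.
have /seq_limP/(_ (L - t))[|N HN] := qL; first by rewrite subr_gt0.
have qt j : t ^+ j * q N <= q (N + j)%N.
  elim: j => [|j IH]; first by rewrite mul1r addn0.
  rewrite exprS -mulrA addnS.
  apply: (@le_trans _ _ (t * q (N + j)%N)); first by rewrite ler_wpM2l// ltW//; lra.
  rewrite -ler_pdivlMr//; have := HN (N + j)%N (leq_addr _ _).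
  by rewrite ltr_norml; lra.
have t0 : 0 < t by lra.
have rt0 : 0 < r / t by exact: divr_gt0.
have rt1 : `|r / t| < 1.
  by rewrite (gtr0_norm rt0) ltr_pdivrMr// mul1r.
have /seq_limP/(_ _ (divr_gt0 (q0 N) (exprn_gt0 N r0))) := cvg_expr rt1.
move=> [M /(_ M (leqnn _))]; rewrite subr0 ltNge => /negP; apply.
apply: le_trans (ler_norm _).
rewrite expr_div_n ler_pdivlMr ?exprn_gt0// mulrAC ler_pdivrMr ?exprn_gt0//.
by rewrite -exprD addnC mulrC; apply: le_trans (qt M) (qr _).
Qed.

Lemma ratio_ge_root (q : nat -> R) (L r : R) : (forall k, 0 < q k) -> 0 < r -> 0 < L ->
  (fun k => q k.+1 / q k) @ \oo --> L -> (forall k, r ^+ k <= q k) -> r <= L.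
Proof.
move=> q0 r0 L0 qL qr.
suff : L^-1 <= r^-1 by rewrite lef_pV2.
apply: (@ratio_le_root (fun k => (q k)^-1)); rewrite ?invr_gt0//.
- by move=> k; rewrite invr_gt0.
- have -> : (fun k => (q k.+1)^-1 / (q k)^-1) = (fun k => (q k.+1 / q k)^-1).
    by apply/funext => k; rewrite invf_div invrK mulrC.
  by apply: seq_limV; rewrite ?gt_eqF.
- by move=> k; rewrite exprVn lef_pV2 ?posrE ?exprn_gt0.
Qed.

End StrictDerivative.

(** * The multiplier at an interior fixed point *)

Section Multiplier.
Context {R : realType}.
Variables (m : nat) (e B N T : R -> R) (lam rho tau : R).
Hypothesis m_ge2 : (2 <= m)%N.
Hypothesis e_lt : forall s t, s < t -> e s < e t.
Hypothesis e01 : forall s, 0 < e s < 1.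
Hypothesis e_to1 : forall x, x < 1 -> exists s, x < e s.
Hypothesis e_cont0 : {for 0, continuous e}.
Hypothesis Be : forall s, B (e s) = e (s / m%:R).
Hypothesis Ne : forall s, N (e s) = e (m%:R * s).
Hypothesis Te : forall s, T (e s) = e (s + 1).
Hypothesis dB : strict_deriv B (e 0) lam.
Hypothesis dN : strict_deriv N 1 rho.
Hypothesis dT : strict_deriv T 1 tau.
Hypothesis lam0 : lam != 0.
Hypothesis rho0 : rho != 0.
Hypothesis tau0 : tau != 0.
Hypothesis shift_strict_deriv : forall J : nat, exists W c,
  [/\ c != 0, strict_deriv W (e 0) c & forall s, W (e s) = e (s + J%:R)].

Let delta s := e (s + 1) - e s.
Let a k := m%:R ^+ k : R.

Let M0 : 0 < m%:R :> R. Proof. by rewrite ltr0n; case: m m_ge2. Qed.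
Let M1 : 1 < m%:R :> R. Proof. by rewrite ltr1n. Qed.

Lemma delta_gt0 s : 0 < delta s.
Proof. by rewrite subr_gt0 e_lt// ltrDl. Qed.

Lemma e_neq (s t : R) : s < t -> e s != e t.
Proof. by move=> /e_lt st; rewrite lt_eqF. Qed.

Definition tends_infty (s : nat -> R) :=
  forall A, exists N, forall k, (N <= k)%N -> A <= s k.

Lemma e_le (s t : R) : s <= t -> e s <= e t.
Proof. by rewrite le_eqVlt => /predU1P[->//|/e_lt/ltW]. Qed.

Lemma e_lim1 s : tends_infty s -> (fun k => e (s k)) @ \oo --> (1 : R).
Proof.
move=> sy; apply/seq_limP => eps eps0.
have [|t te] := e_to1 (x := 1 - eps); first by rewrite ltrBlDr ltrDl.
have [K HK] := sy t; exists K => k /HK /e_le; have := e01 (s k).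
by rewrite ltr_norml; lra.
Qed.

Lemma tends_inftyD s c : tends_infty s -> tends_infty (fun k => s k + c).
Proof.
move=> sy A; have [K HK] := sy (A - c); exists K => k /HK; lra.
Qed.

Lemma tends_inftyM s : tends_infty s -> tends_infty (fun k => m%:R * s k).
Proof.
move=> sy A; have [K HK] := sy (A / m%:R); exists K => k /HK.
by rewrite ler_pdivrMr// mulrC.
Qed.

Arguments tends_inftyD {s} c.

Lemma T_ratio s : tends_infty s ->
  (fun k => delta (s k + 1) / delta (s k)) @ \oo --> tau.
Proof.
move=> sy.
have := strict_deriv_slope dT (u := fun k => e (s k)) (v := fun k => e (s k + 1)).
move=> /(_ _ _ _ _ _) H.
have {}H : (fun k => (T (e (s k + 1)) - T (e (s k))) / (e (s k + 1) - e (s k))) @ \oo --> tau.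
  apply: H => [k|k|k||]; rewrite ?e01//; first by apply: e_neq; rewrite ltrDl.
    exact: e_lim1.
  by apply: e_lim1; exact: tends_inftyD.
by move: H; under eq_fun do rewrite !Te.
Qed.

Lemma T_ratio_iter i s : tends_infty s ->
  (fun k => delta (s k + i%:R) / delta (s k)) @ \oo --> tau ^+ i.
Proof.
move=> sy; elim: i => [|i IH].
  rewrite expr0; apply/seq_limP => eps eps0; exists 0%N => k _.
  by rewrite addr0 divff ?gt_eqF ?delta_gt0// subrr normr0.
rewrite exprS; have /T_ratio := tends_inftyD i%:R sy => Hi.
have := seq_limM Hi IH; apply: cvg_trans; apply: near_eq_cvg; apply: filterE => k /=.
have d0 := delta_gt0 (s k); have d1 := delta_gt0 (s k + i%:R).
rewrite -addrA -natr1; field; by rewrite !gt_eqF.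
Qed.

Arguments T_ratio_iter i {s}.

Lemma telescope_delta s : \sum_(i < m) delta (s + i%:R) = e (s + m%:R) - e s.
Proof.
have := telescope_sumr (fun k => e (s + k%:R)) (leq0n m).
rewrite addr0 => <-; rewrite big_mkord.
by apply: eq_bigr => i _; rewrite /delta -addrA natr1.
Qed.

Let K := \sum_(i < m) tau ^+ i.

Lemma sum_ratio s : tends_infty s ->
  (fun k => (e (s k + m%:R) - e (s k)) / delta (s k)) @ \oo --> K.
Proof.
move=> sy; have := seq_lim_sum (m := m) (u := fun i k => _) (fun i => T_ratio_iter i sy).
by under eq_fun do rewrite -mulr_suml telescope_delta.
Qed.

(** [N] maps the unit interval at [s] onto the [m] unit intervals starting at [m * s]. *)
Lemma N_ratio s : tends_infty s ->
  (fun k => (e (m%:R * s k + m%:R) - e (m%:R * s k)) / delta (s k)) @ \oo --> rho.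
Proof.
move=> sy.
have := strict_deriv_slope dN (u := fun k => e (s k)) (v := fun k => e (s k + 1)).
move=> /(_ _ _ _ _ _) H.
have {}H : (fun k => (N (e (s k + 1)) - N (e (s k))) / (e (s k + 1) - e (s k))) @ \oo --> rho.
  apply: H => [k|k|k||]; rewrite ?e01//; first by apply: e_neq; rewrite ltrDl.
    exact: e_lim1.
  by apply: e_lim1; exact: tends_inftyD.
by move: H; under eq_fun do rewrite !Ne mulrDr mulr1.
Qed.

Lemma seq_lim_gt0 u (c : R) : (forall k, 0 < u k) -> c != 0 -> u @ \oo --> c -> 0 < c.
Proof.
move=> u0 c0 uc; rewrite lt_neqAle eq_sym c0 /= leNgt; apply/negP => cn.
have /seq_limP/(_ (- c)) := uc; rewrite oppr_gt0 => /(_ cn)[k /(_ k (leqnn _))].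
by have := u0 k; rewrite ltr_norml; lra.
Qed.

Lemma tends_infty_nat : tends_infty (fun k => k%:R).
Proof.
move=> A; exists (Num.truncn A).+1 => k.
rewrite -(ler_nat R); apply: le_trans; exact/ltW/truncnS_gt.
Qed.

Lemma tends_infty_a : tends_infty a.
Proof.
move=> A; have [K' HK] := tends_infty_nat A; exists K' => k /HK /le_trans; apply.
by rewrite /a -natrX ler_nat ltnW// ltn_expl.
Qed.

Lemma tau_gt0 : 0 < tau.
Proof.
apply: seq_lim_gt0 tau0 (T_ratio tends_infty_a) => k.
by rewrite divr_gt0 ?delta_gt0.
Qed.

Lemma K_gt0 : 0 < K.
Proof.
rewrite /K; case: m m_ge2 => // m' _; rewrite big_ord_recl expr0.
rewrite ltr_pwDl ?ltr01// sumr_ge0// => i _; rewrite exprn_ge0// ltW//.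
exact: tau_gt0.
Qed.

Lemma rho_gt0 : 0 < rho.
Proof.
apply: seq_lim_gt0 rho0 (N_ratio tends_infty_a) => k.
by rewrite divr_gt0 ?delta_gt0// subr_gt0 e_lt// ltrDl.
Qed.

Lemma delta_ratio_K s : tends_infty s ->
  (fun k => delta (m%:R * s k) / delta (s k)) @ \oo --> rho / K.
Proof.
move=> sy; have := seq_limM (N_ratio sy)
  (seq_limV (lt0r_neq0 K_gt0) (sum_ratio (tends_inftyM sy))).
apply: cvg_trans; apply: near_eq_cvg; apply: filterE => k /=.
have d0 := delta_gt0 (s k); have d1 := delta_gt0 (m%:R * s k).
have d2 : 0 < e (m%:R * s k + m%:R) - e (m%:R * s k) by rewrite subr_gt0 e_lt// ltrDl.
by field; rewrite !gt_eqF.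
Qed.

(** [N] conjugates [T] to [T ^ m], so [tau ^ m = tau]. The two sides arise by computing
    in two ways the limit of [delta (m * s + m) / delta s] along [s = m ^ k]. *)
Lemma tau_eq1 : tau = 1.
Proof.
have ay := tends_infty_a; have ay1 := tends_inftyD 1 ay.
have H1 := seq_limM (T_ratio_iter m (tends_inftyM ay)) (delta_ratio_K ay).
have H2 := seq_limM (delta_ratio_K ay1) (T_ratio ay).
have : tau ^+ m * (rho / K) = rho / K * tau.
  apply: seq_lim_unique H1 _; apply: cvg_trans H2.
  apply: near_eq_cvg; apply: filterE => k /=.
  have d0 := delta_gt0 (a k); have d1 := delta_gt0 (a k + 1).
  have d2 := delta_gt0 (m%:R * a k).
  by rewrite mulrDr mulr1; field; rewrite !gt_eqF.
rewrite mulrC => /mulfI; have rK : 0 < rho / K by rewrite divr_gt0 ?rho_gt0 ?K_gt0.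
move=> /(_ (lt0r_neq0 rK)).
rewrite -[in tau ^+ m](prednK (ltnW m_ge2)) exprS -[RHS]mulr1.
move=> /(mulfI tau0)/eqP.
by rewrite pexpr_eq1 ?ltW ?tau_gt0// => [/eqP//|]; case: m m_ge2 => [|[]].
Qed.

(** With [tau = 1] the [m] image intervals share the expansion [rho] equally. *)
Lemma delta_ratio s : tends_infty s ->
  (fun k => delta (m%:R * s k) / delta (s k)) @ \oo --> rho / m%:R.
Proof.
move=> sy; have := delta_ratio_K sy; rewrite /K tau_eq1.
by under eq_bigr do rewrite expr1n; rewrite sumr_const card_ord.
Qed.

Lemma e_scaled_to0 c : (fun l => e (c / m%:R ^+ l)) @ \oo --> e 0.
Proof.
apply/seq_limP => eps eps0.
have /continuous_distP/(_ _ eps0)[d d0 H] := e_cont0.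
have c1 : 0 < `|c| + 1 by have := normr_ge0 c; lra.
have [k0 Hk] := tends_infty_a ((`|c| + 1) / d).
exists k0 => k /Hk kc; apply: H; rewrite subr0 normrM normfV.
have ak : 0 < m%:R ^+ k :> R by rewrite exprn_gt0.
rewrite (gtr0_norm ak) ltr_pdivrMr//; move: kc.
by rewrite ler_pdivrMr// /a mulrC; have := normr_ge0 c; lra.
Qed.

Let b J l := e (m%:R ^+ J + 1 / m%:R ^+ l) - e (m%:R ^+ J).

Lemma b_gt0 J l : 0 < b J l.
Proof. by rewrite subr_gt0 e_lt// ltrDl divr_gt0// exprn_gt0. Qed.

(** [B] shrinks the interval from [e 0] to [e (1 / m ^ l)] by [lam] in the limit, and a
    translation moves it to [e (m ^ J)] without changing ratios. *)
Lemma b_ratio J : (fun l => b J l.+1 / b J l) @ \oo --> lam.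
Proof.
have [W [c [c0 dW We]]] := shift_strict_deriv (m ^ J)%N.
have v0 := e_scaled_to0 1; pose v l := e (1 / m%:R ^+ l).
have v1 l : v l.+1 = B (v l) by rewrite /v Be exprSr invfM mulrA.
have pl l : 0 < 1 / m%:R ^+ l :> R by rewrite divr_gt0// exprn_gt0.
have v1lim : (fun l => v l.+1) @ \oo --> e 0.
  by have := v0; rewrite -(cvg_shiftS (fun l => e (1 / m%:R ^+ l))).
have cst0 : (fun _ : nat => e 0) @ \oo --> e 0 by exact: cvg_cst.
have slope g q (w : nat -> R) (p : nat -> R) : strict_deriv g (e 0) q ->
    (forall l, 0 < p l) -> (forall l, w l = e (p l)) -> w @ \oo --> e 0 ->
    (fun l => (g (w l) - g (e 0)) / (w l - e 0)) @ \oo --> q.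
  move=> dg p0 wp w0; refine (strict_deriv_slope dg _ _ _ cst0 w0) => l //.
    by rewrite wp.
  by rewrite wp; exact: (e_neq (p0 l)).
have SB := slope _ _ v _ dB pl (fun=> erefl) v0.
have SW := slope _ _ v _ dW pl (fun=> erefl) v0.
have SW1 := slope _ _ (fun l => v l.+1) _ dW (fun l => pl l.+1) (fun=> erefl) v1lim.
have bE l : b J l = W (v l) - W (e 0).
  by rewrite /b /v /= !We natrX add0r [1 / _ + _]addrC.
have := seq_limM SB (seq_limM SW1 (seq_limV c0 SW)).
rewrite divff// mulr1; apply: cvg_trans; apply: near_eq_cvg; apply: filterE => l.
rewrite /= -bE -bE -v1 Be mul0r.
have h0 := b_gt0 J l; have h1 := b_gt0 J l.+1.
have h2 : 0 < v l - e 0 by rewrite subr_gt0 e_lt.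
have h3 : 0 < v l.+1 - e 0 by rewrite subr_gt0 e_lt.
by field; rewrite !gt_eqF.
Qed.

(** [N] expands by almost [rho] near the endpoint [1], uniformly; starting at a large
    [m ^ J] keeps every one of the [i] steps in that region. *)
Lemma delta_b (eps : R) : 0 < eps < rho -> exists J, forall l i, (i <= l)%N ->
  (rho - eps) ^+ i * b J l <= e (m%:R ^+ (J + i) + m%:R ^+ i / m%:R ^+ l)
                              - e (m%:R ^+ (J + i)) <= (rho + eps) ^+ i * b J l.
Proof.
move=> /andP[eps0 epsr]; have [d d0 H] := dN eps0.
have [|t te] := e_to1 (x := 1 - d); first by rewrite ltrBlDr ltrDl.
have [J HJ] := tends_infty_a t; exists J => l.
elim=> [|i IH] il; first by rewrite addn0 !expr0 [1 * b J l]mul1r /b !lexx.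
have {IH} /andP[IH1 IH2] := IH (ltnW il).
set p := m%:R ^+ (J + i) in IH1 IH2; set s := m%:R ^+ i / m%:R ^+ l in IH1 IH2.
have s0 : 0 < s by rewrite /s divr_gt0// exprn_gt0.
have near1 y : p <= y -> `|e y - 1| < d.
  move=> py; have tp : e t <= e y.
    by apply/e_le/(le_trans _ py)/HJ; exact: leq_addr.
  by have := e01 y; rewrite ltr_norml; lra.
have := H (e p) (e (p + s)) (e01 _) (e01 _) (near1 _ (lexx _)) (near1 _ _).
rewrite lerDl ltW// => /(_ isT); rewrite !Ne.
have es : e p < e (p + s) by rewrite e_lt// ltrDl.
rewrite [`|e (p + s) - e p|]gtr0_norm ?subr_gt0// ler_norml => /andP[H1 H2].
have -> : m%:R ^+ (J + i.+1) = m%:R * p by rewrite addnS exprS.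
have -> : m%:R * p + m%:R ^+ i.+1 / m%:R ^+ l = m%:R * (p + s).
  by rewrite /s exprS mulrDr mulrA.
rewrite !exprS -!mulrA; apply/andP; split.
  apply: (@le_trans _ _ ((rho - eps) * (e (p + s) - e p))); last by lra.
  by rewrite ler_wpM2l// subr_ge0 ltW.
apply: (@le_trans _ _ ((rho + eps) * (e (p + s) - e p))); first by lra.
by rewrite ler_wpM2l// addr_ge0// ltW// (lt_trans eps0).
Qed.

Lemma lam_gt0 : 0 < lam.
Proof. by apply: seq_lim_gt0 lam0 (b_ratio 0) => k; rewrite divr_gt0 ?b_gt0. Qed.

(** The unit interval at [m ^ (J + l)] is the image under [l] steps of [N] of the
    interval of parameter length [1 / m ^ l] at [m ^ J]. The quotient of their lengths
    therefore grows like [rho ^ l], and its ratios tend to [rho / m / lam]. *)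
Theorem multiplier : lam = m%:R^-1.
Proof.
have r0 := rho_gt0; have l0 := lam_gt0.
pose L := rho / m%:R / lam; have L0 : 0 < L by rewrite /L !divr_gt0.
have Lr eps : 0 < eps < rho -> rho - eps <= L <= rho + eps.
  move=> epsr; have [J HJ] := delta_b epsr; move/andP: epsr => [eps0 epsr].
  pose q l := delta (a (J + l)%N) / b J l.
  have q0 l : 0 < q l by rewrite divr_gt0 ?b_gt0 ?delta_gt0.
  have qb l : (rho - eps) ^+ l <= q l <= (rho + eps) ^+ l.
    rewrite ler_pdivlMr ?b_gt0// ler_pdivrMr ?b_gt0//.
    by have := HJ l l (leqnn _); rewrite divff ?expf_neq0 ?gt_eqF.
  have qL : (fun l => q l.+1 / q l) @ \oo --> L.
    have sy : tends_infty (fun l => a (J + l)%N).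
      move=> A; have [k0 Hk] := tends_infty_a A; exists k0 => k k0k; apply: Hk.
      exact: (leq_trans k0k (leq_addl _ _)).
    have := seq_limM (delta_ratio sy) (seq_limV lam0 (b_ratio J)).
    apply: cvg_trans; apply: near_eq_cvg; apply: filterE => l /=.
    have h0 := b_gt0 J l; have h1 := b_gt0 J l.+1.
    have h2 := delta_gt0 (a (J + l)%N).
    rewrite /q /a addnS exprS; move: h2; rewrite /a => h2.
    by field; rewrite !gt_eqF.
  apply/andP; split.
    apply: (ratio_ge_root q0) qL _ => //; first by rewrite subr_gt0.
    by move=> k; case/andP: (qb k).
  apply: (ratio_le_root q0) qL _; first by rewrite addr_gt0.
  by move=> k; case/andP: (qb k).
have LE : L = rho.
  apply/eqP; rewrite eq_le; apply/andP; split; apply/ler_addgt0Pl => eps eps0.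
    have [er|re] := ltP eps rho; first by have /andP[] := Lr eps (introT andP (conj eps0 er)); lra.
    have /andP[] : rho - rho / 2 <= L <= rho + rho / 2 by apply: Lr; lra.
    by lra.
  have [er|re] := ltP eps rho; last by lra.
  by have /andP[] := Lr eps (introT andP (conj eps0 er)); lra.
move: LE; rewrite /L -mulrA -[RHS]mulr1 => /(mulfI rho0) E.
by apply/esym/divr1_eq.
Qed.

End Multiplier.

(** * Uniform estimates and orbit sums *)

Section RealAnalysis.
Context {R : realType}.
Implicit Types (g h w : R -> R) (x y z p : R).

Lemma uniformly_continuous_segment g al be :
  (forall x, al <= x <= be -> {for x, continuous g}) ->
  forall eps, 0 < eps -> exists2 d, 0 < d &
    forall x y, al <= x <= be -> `|y - x| < d -> `|g y - g x| < eps.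
Proof.
move=> cg eps eps0.
have := @segment_compact R al be; rewrite compact_near_coveringP.
move=> /(_ R 0^'+ (fun d x => forall y, `|y - x| < d -> `|g y - g x| < eps)).
move=> /(_ _) H.
have : \forall d \near 0^'+, forall x, x \in `[al, be] ->
    forall y, `|y - x| < d -> `|g y - g x| < eps.
  apply: H => x; rewrite /= in_itv /= => /cg /continuous_distP.
  move=> /(_ (eps / 2)) []; first by lra.
  move=> d d0 Hd; exists ([set y | `|y - x| < d / 2], [set t | t < d / 2]) => /=.
    split; first by apply/nearP; exists (d / 2) => //; lra.
    by apply: nbhs_right_lt; lra.
  move=> [x' t] /= [xx' td] y yx'; have := ler_distD x' y x.
  have ? := Hd x'; move=> ?; have /Hd ? : `|y - x| < d by lra.
  have ? : `|g x' - g x| < eps / 2 by apply: Hd; lra.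
  by have := ler_distD (g x) (g y) (g x'); rewrite (distrC (g x)); lra.
rewrite /at_right near_withinE => /nearP[d d0 Hd].
exists (d / 2); first by lra.
move=> x y xab; apply: (Hd (d / 2)) => //; last by lra.
by rewrite subr0 gtr0_norm; lra.
Qed.

Lemma is_derive_distP g x c : is_derive x 1 g c <->
  forall eps, 0 < eps -> exists2 d, 0 < d &
    forall y, `|y - x| < d -> `|g y - g x - c * (y - x)| <= eps * `|y - x|.
Proof.
split=> [[dg E] eps eps0|H].
  move: dg; rewrite /derivable => /cvg_ex[l /= gl].
  have lc : l = c.
    by rewrite -E /derive; apply/esym/cvg_lim => //; exact: gl.
  rewrite {}lc in gl.
  move: gl => /cvgrPdist_le /(_ _ eps0).
  rewrite near_withinE => /nearP[d d0 Hd]; exists d => // y yx.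
  have [->|yx0] := eqVneq y x; first by rewrite !subrr mulr0 subrr normr0 mulr0.
  have yx1 : y - x != 0 by rewrite subr_eq0.
  have := Hd (y - x); rewrite subr0 => /(_ yx yx1).
  rewrite /= [_ *: 1]mulr1 subrK /GRing.scale /= => Hy.
  have -> : g y - g x - c * (y - x) = - (c - (y - x)^-1 * (g y - g x)) * (y - x).
    by field.
  by rewrite normrM normrN ler_wpM2r.
have cv : (fun h : R => h^-1 *: (g (h *: 1 + x) - g x)) @ 0^' --> c.
  apply/cvgrPdist_le => eps eps0; have [d d0 Hd] := H _ eps0.
  rewrite near_withinE; apply/nearP; exists d => // h; rewrite subr0 => hd h0.
  rewrite /= [_ *: 1]mulr1 /GRing.scale /=.
  have := Hd (h + x); rewrite addrK => /(_ hd) Hh.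
  have -> : c - h^-1 * (g (h + x) - g x) = - (g (h + x) - g x - c * h) / h by field.
  by rewrite normrM normrN normfV ler_pdivrMr// normr_gt0.
by split; [apply/cvg_ex; exists c|exact: cvg_lim].
Qed.

(** The error has to be uniform in the base point to be summed along orbits. *)
Lemma C1_uniform_littleo g (g' : R -> R) p d :
  (forall y, `|y - p| <= d -> is_derive y 1 g (g' y)) ->
  (forall y, `|y - p| <= d -> {for y, continuous g'}) ->
  forall eps, 0 < eps -> exists2 del, 0 < del &
    forall x y, `|x - p| < d -> `|y - p| < d -> `|y - x| < del ->
     `|g y - g x - g' x * (y - x)| <= eps * `|y - x|.
Proof.
move=> dg cg eps eps0.
have [|del del0 H] := @uniformly_continuous_segment g' (p - d) (p + d) _ eps eps0.
  by move=> x xpd; apply: cg; rewrite ler_norml; lra.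
exists del => // x y xp yp yx.
have [c|c [cp _ cx ->]] := @MVT_ball R g g' p d x y _ xp yp.
  by move=> /ltW; exact: dg.
rewrite -mulrBl normrM ler_wpM2r// ltW// H ?(le_lt_trans cx)//.
by move: xp; rewrite ltr_norml; lra.
Qed.

(** Unrolling a functional inequality along an orbit: the weights have bounded
    products and the errors decay geometrically, so the errors add up to a
    multiple of the first one. *)
Lemma unroll_bound (E al : nat -> R) (B r q : R) : 0 <= r -> 0 <= q < 1 ->
  (forall k, 0 <= al k) -> (forall k, \prod_(j < k) al j <= B) ->
  (forall k, E k <= al k * E k.+1 + r * q ^+ k) ->
  (forall eps, 0 < eps -> exists k, E k < eps) ->
  E 0%N <= B * r / (1 - q).
Proof.
move=> r0 /andP[q0 q1] al0 alB EE Elim.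
have B0 : 0 < B by apply: lt_le_trans (alB 0%N); rewrite big_ord0.
have H k : E 0%N <= (\prod_(j < k) al j) * E k + B * r * (1 - q ^+ k) / (1 - q).
  elim: k => [|k IH]; first by rewrite big_ord0 mul1r expr0 subrr mulr0 mul0r addr0.
  apply: (le_trans IH); rewrite big_ord_recr /=.
  have P0 : 0 <= \prod_(j < k) al j by rewrite prodr_ge0.
  have : \prod_(j < k) al j * E k <=
      \prod_(j < k) al j * (al k * E k.+1 + r * q ^+ k) by rewrite ler_wpM2l.
  have : \prod_(j < k) al j * (r * q ^+ k) <= B * (r * q ^+ k).
    by rewrite ler_wpM2r// mulr_ge0// exprn_ge0.
  have -> : B * r * (1 - q ^+ k.+1) / (1 - q) =
     B * r * (1 - q ^+ k) / (1 - q) + B * (r * q ^+ k).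
    by rewrite exprS; field; rewrite subr_eq0 gt_eqF.
  by rewrite mulrDr mulrA; lra.
apply/ler_addgt0Pr => eps eps0.
have [k Ek] := Elim (eps / B) (divr_gt0 eps0 B0).
apply: (le_trans (H k)); rewrite addrC lerD//.
  rewrite ler_pM2r ?invr_gt0 ?subr_gt0// -[leRHS]mulr1 ler_wpM2l//.
    by rewrite mulr_ge0// ltW.
  by rewrite lerBlDr lerDl exprn_ge0.
have P0 : 0 <= \prod_(j < k) al j by rewrite prodr_ge0.
have [Ek0|Ek0] := leP (E k) 0; first by apply: le_trans (ltW eps0); rewrite mulr_ge0_le0.
apply: (@le_trans _ _ (B * E k)); first by rewrite ler_wpM2r// ltW.
by rewrite mulrC -ler_pdivlMr// ltW.
Qed.

End RealAnalysis.

(** * Functional equations at an attracting fixed point *)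

Section Contraction.
Context {R : realType}.
Implicit Types (w a b c v : R -> R) (x y z : R).
Variables (G G' : R -> R) (p kap : R).
Hypothesis Gp : G p = p.
Hypothesis kap01 : 0 < kap < 1.
Hypothesis dG : \forall y \near p, is_derive (y : R) 1 G (G' y).
Hypothesis cG' : \forall y \near p, {for y, continuous G'}.
Hypothesis bG' : \forall y \near p, `|G' y| <= kap.

Definition contracting d := forall y z, `|y - p| < d -> `|z - p| < d ->
  `|G y - G z| <= kap * `|y - z|.

Lemma contracting_near : exists2 d, 0 < d & contracting d.
Proof.
have [d d0 H] := (nearP _ _).1 (filterI dG bG'); exists d => // y z yd zd.
have [c /H[]//|c [cd _ _ ->]] := @MVT_ball R G G' p d z y _ zd yd.
by rewrite normrM ler_wpM2r//; case: (H _ cd).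
Qed.

Lemma contracting_le d d' : d' <= d -> contracting d -> contracting d'.
Proof. by move=> dd H y z yd zd; apply: H; exact: lt_le_trans dd. Qed.

Lemma contracting_ball d y : contracting d -> `|y - p| < d ->
  `|G y - p| <= kap * `|y - p| /\ `|G y - p| < d.
Proof.
move=> H yd; have d0 : 0 < d := le_lt_trans (normr_ge0 _) yd.
have := H y p yd; rewrite subrr normr0 Gp => /(_ d0) Hy; split=> //.
apply: le_lt_trans Hy (le_lt_trans _ yd); case/andP: kap01 => k0 k1.
by rewrite -[leRHS]mul1r ler_wpM2r// ltW.
Qed.

Lemma iter_ball d k y : contracting d -> `|y - p| < d -> `|iter k G y - p| < d.
Proof.
by move=> H; elim: k => //= k IH /IH yd; case: (contracting_ball H yd).
Qed.

Lemma iter_contract d k y z : contracting d -> `|y - p| < d -> `|z - p| < d ->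
  `|iter k G y - iter k G z| <= kap ^+ k * `|y - z|.
Proof.
move=> H yd zd; case/andP: kap01 => k0 k1.
elim: k => [|k IH] /=; first by rewrite mul1r.
apply: (le_trans (H _ _ (iter_ball _ H yd) (iter_ball _ H zd))).
by rewrite exprS -mulrA ler_pM2l.
Qed.

Lemma expr_small (q D eps : R) : 0 <= q < 1 -> 0 <= D -> 0 < eps ->
  exists N, forall k, (N <= k)%N -> q ^+ k * D < eps.
Proof.
move=> /andP[q0 q1] D0 eps0.
have D1 : 0 < D + 1 by lra.
have q1' : `|q| < 1 by rewrite ger0_norm.
have /seq_limP/(_ _ (divr_gt0 eps0 D1))[N HN] := cvg_expr q1'.
exists N => k /HN; rewrite subr0 ger0_norm ?exprn_ge0// ltr_pdivlMr// => H.
by apply: le_lt_trans H; rewrite ler_wpM2l ?exprn_ge0//; lra.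
Qed.

(** Both orbits tend to [p]. *)
Lemma iter_merge w d y z eps : contracting d -> {for p, continuous w} ->
  `|y - p| < d -> `|z - p| < d -> 0 < eps ->
  exists N, forall k, (N <= k)%N -> `|w (iter k G y) - w (iter k G z)| < eps.
Proof.
move=> H cw yd zd eps0; case/andP: (kap01) => k0 k1.
move/continuous_distP : cw => /(_ (eps / 2)) []; first by lra.
move=> t t0 Ht.
have [||N HN] := @expr_small kap d t _ _ t0; first by rewrite ltW.
  by apply/ltW/(le_lt_trans _ yd).
exists N => k /HN Hk.
have orb u : `|u - p| < d -> `|w (iter k G u) - w p| < eps / 2.
  move=> ud; apply: Ht; apply: le_lt_trans Hk.
  have := iter_contract k H ud (z := p).
  rewrite (iter_fix _ Gp) subrr normr0 => /(_ (le_lt_trans (normr_ge0 _) yd)).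
  by move=> /le_trans; apply; rewrite ler_wpM2l ?exprn_ge0// ltW.
have := orb _ yd; have := orb _ zd.
by have := ler_distD (w p) (w (iter k G y)) (w (iter k G z)); rewrite (distrC (w p)); lra.
Qed.

Definition orbit_prod a k y := \prod_(j < k) a (iter j G y).

(** The condition under which a continuous solution of [w = b + a * (w \o G)] is controlled
    by its values near [p]; it allows [a p = 1]. *)
Definition bounded_orbit_prods a := exists B, \forall y \near p, forall k,
  `|orbit_prod a k y| <= B.

Lemma orbit_prodS a k y : orbit_prod a k.+1 y = a y * orbit_prod a k (G y).
Proof.
rewrite /orbit_prod big_ord_recl /=; congr (_ * _).
by apply: eq_bigr => i _; rewrite -iterSr.
Qed.

(** The solution is the sum of [c] along the orbit of [G], weighted by the products of
    [A]. The partial sums are continuous and converge uniformly. *)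
Lemma cohomological_solution A c (M q : R) : 0 <= q < 1 ->
  (\forall y \near p, {for y, continuous A}) ->
  (\forall y \near p, {for y, continuous c}) ->
  (\forall y \near p, forall k, `|orbit_prod A k y * c (iter k G y)| <= M * q ^+ k) ->
  exists v, [/\ \forall y \near p, {for y, continuous v},
    \forall y \near p, v y = c y + A y * v (G y) & c p = 0 -> v p = 0].
Proof.
move=> /andP[q0 q1] cA cc bnd; pose t y k := orbit_prod A k y * c (iter k G y).
pose S k y := \sum_(j < k) t y j.
have SS k y : S k.+1 y = c y + A y * S k (G y).
  rewrite /S big_ord_recl /t {1}/orbit_prod big_ord0 mul1r; congr (_ + _).
  rewrite mulr_sumr; apply: eq_bigr => i _.
  by rewrite lift0 orbit_prodS iterSr mulrA.
pose v y := lim ((S ^~ y) @ \oo).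
have [d0 d00 ctr] := contracting_near.
have [d1 d10 H] := (nearP _ _).1 (filterI (filterI cA cc) (filterI bnd dG)).
pose d := Num.min d0 d1.
have d_gt0 : 0 < d by rewrite lt_min d00.
have ctrd : contracting d by apply: contracting_le ctr; rewrite ge_min lexx.
have {}H y : `|y - p| < d -> [/\ {for y, continuous A}, {for y, continuous c},
    {for y, continuous G} & forall k, `|t y k| <= M * q ^+ k].
  rewrite lt_min => /andP[_ /H[[? ?] [? /is_derive_continuous ?]]]; by split.
clearbody d; have M0 : 0 <= M.
  have [|_ _ _ /(_ 0%N)] := H p; first by rewrite subrr normr0.
  by rewrite mulr1; exact: le_trans.
have Scvg y : `|y - p| < d -> (S ^~ y) @ \oo --> v y.
  move=> /H[_ _ _ Hy]; apply/cvg_ex.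
  have : cvgn (series (t y)).
    apply: normed_cvg; apply: (@series_le_cvg _ _ (geometric M q)).
    - by move=> k; exact: normr_ge0.
    - by move=> k; rewrite /geometric /= mulr_ge0// exprn_ge0.
    - by move=> k; exact: Hy.
    - by apply: is_cvg_geometric_series; rewrite ger0_norm.
  rewrite /v; have -> : series (t y) = S ^~ y.
    by apply/funext => k; rewrite /series /= /S big_mkord.
  by move=> cv; exists (lim ((S ^~ y) @ \oo)).
have veq y : `|y - p| < d -> v y = c y + A y * v (G y).
  move=> yd; have [_ Gyd] := contracting_ball ctrd yd.
  have H1 : (fun k => S k.+1 y) @ \oo --> v y.
    by have := Scvg _ yd; rewrite -(cvg_shiftS (S ^~ y)).
  apply: seq_lim_unique H1 _; under eq_fun do rewrite SS.
  by apply: cvgD; [exact: cvg_cst|apply: cvgM; [exact: cvg_cst|exact: Scvg]].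
have Scont k y : `|y - p| < d -> {for y, continuous (S k)}.
  elim: k y => [|k IH] y yd.
    have -> : S 0%N = cst 0 by apply/funext => z; rewrite /S big_ord0.
    exact: cvg_cst.
  have -> : S k.+1 = (fun z => c z + A z * S k (G z)).
    by apply/funext => z; rewrite SS.
  have [cAy ccy cGy _] := H _ yd; have [_ Gyd] := contracting_ball ctrd yd.
  apply: continuousD ccy _; apply: continuousM cAy _.
  by apply: continuous_comp cGy _; exact: IH.
have tail k y : `|y - p| < d -> `|v y - S k y| <= M * q ^+ k / (1 - q).
  move=> yd; have [_ _ _ Hy] := H _ yd.
  have Sl l : `|S (k + l)%N y - S k y| <= M * q ^+ k / (1 - q).
    have : `|S (k + l)%N y - S k y| <= M * q ^+ k * (1 - q ^+ l) / (1 - q).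
      elim: l => [|l IH]; first by rewrite addn0 !subrr normr0 mulr0 mul0r.
      rewrite addnS {1}/S big_ord_recr /= -/(S (k + l)%N y) addrAC.
      apply: (le_trans (ler_normD _ _)); apply: (le_trans (lerD IH (Hy _))).
      rewrite exprD exprS le_eqVlt; apply/orP; left; apply/eqP.
      by field; rewrite subr_eq0 gt_eqF.
    move=> /le_trans; apply; rewrite ler_pM2r ?invr_gt0 ?subr_gt0//.
    rewrite -[leRHS]mulr1 ler_wpM2l//; first by rewrite mulr_ge0// exprn_ge0.
    by rewrite lerBlDr lerDl exprn_ge0.
  apply/ler_addgt0Pr => eps eps0.
  have /seq_limP/(_ _ eps0)[N HN] := Scvg _ yd.
  have := HN (k + N)%N (leq_addl _ _); have := Sl N.
  by have := ler_distD (S (k + N)%N y) (v y) (S k y); rewrite (distrC (v y) (S (k + N)%N y)); lra.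
exists v; split.
- apply/nearP; exists d => // y yd; apply/continuous_distP => eps eps0.
  have q1' : 0 < 1 - q by rewrite subr_gt0.
  have [|||k /(_ k (leqnn _)) Hk] := @expr_small q (M / (1 - q)) (eps / 4); first by rewrite q0.
    by rewrite divr_ge0// ltW.
    by lra.
  have tl z : `|z - p| < d -> `|v z - S k z| < eps / 4.
    by move=> /(tail k) /le_lt_trans; apply; rewrite mulrAC mulrC.
  have /continuous_distP/(_ (eps / 4)) [|e1 e10 He] := Scont k y yd; first by lra.
  exists (Num.min e1 (d - `|y - p|)); first by rewrite lt_min e10 subr_gt0.
  move=> z; rewrite lt_min => /andP[/He Sz zy].
  have zd : `|z - p| < d by exact: ball_trans zy.
  have := tl _ zd; have := tl _ yd.
  have := ler_distD (S k z) (v z) (v y); have := ler_distD (S k y) (S k z) (v y).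
  by rewrite (distrC (S k y) (v y)); lra.
- by apply/nearP; exists d => // y; exact: veq.
- move=> cp0; apply/cvg_lim => //; apply/seq_limP => eps eps0; exists 0%N => k _.
  rewrite /S big1 ?subrr ?normr0// => i _.
  by rewrite /t (iter_fix _ Gp) cp0 mulr0.
Qed.

Lemma iter_eventually_ball w d y z eps : contracting d ->
  {for p, continuous w} -> `|y - p| < d -> `|z - p| < d -> 0 < eps ->
  exists k, `|w (iter k G y) - w (iter k G z)| < eps /\
            `|iter k G y - iter k G z| < eps.
Proof.
move=> H cw yd zd eps0; have [N HN] := iter_merge H cw yd zd eps0.
have [|N' HN'] := iter_merge (w := id) H _ yd zd eps0; first exact: cvg_id.
exists (maxn N N'); split; [apply: HN|apply: HN']; [exact: leq_maxl|exact: leq_maxr].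
Qed.

Lemma continuous_near_bounded w : (\forall y \near p, {for y, continuous w}) ->
  \forall y \near p, {for y, continuous w} /\ `|w y| <= `|w p| + 1.
Proof.
move=> cw; have := continuous_bounded (nbhs_singleton cw).
by apply: filterS2 cw => y.
Qed.

(** The equation obtained by formal differentiation determines the derivative. The error
    [w z - w u - v u * (z - u)] of the first-order expansion satisfies along orbits the
    equation of [w], with a remainder that is [o(z - u)] uniformly, and [G] contracts the
    increments, so [unroll_bound] makes the error itself [o(z - u)]. *)
Lemma C1_solution a a' b b' w v :
  (\forall y \near p, is_derive (y : R) 1 a (a' y)) ->
  (\forall y \near p, is_derive (y : R) 1 b (b' y)) ->
  (\forall y \near p, {for y, continuous a'}) ->
  (\forall y \near p, {for y, continuous b'}) ->
  (\forall y \near p, {for y, continuous w}) ->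
  (\forall y \near p, w y = b y + a y * w (G y)) ->
  bounded_orbit_prods a ->
  (\forall y \near p, {for y, continuous v}) ->
  (\forall y \near p, v y = (a' y * w (G y) + b' y) + a y * G' y * v (G y)) ->
  \forall y \near p, is_derive (y : R) 1 w (v y).
Proof.
move=> da db ca' cb' cw weq [B bnd] cv veq; case/andP: (kap01) => k0 k1.
have ca : \forall y \near p, {for y, continuous a}.
  by apply: filterS da => y; exact: is_derive_continuous.
have [d0 d00 ctr0] := contracting_near.
have {ca} /nearP[d1 d10 H1] := continuous_near_bounded ca.
have {ca'} /nearP[d2 d20 H2] := continuous_near_bounded ca'.
have {cw} /nearP[d3 d30 H3] := continuous_near_bounded cw.
have {cv} /nearP[d4 d40 H4] := continuous_near_bounded cv.
have [d5 d50 H5] := (nearP _ _).1 (filterI (filterI weq veq) (filterI bnd cb')).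
have [d6 d60 H6] := (nearP _ _).1 (filterI (filterI da db) (filterI dG cG')).
have [d d_gt0 [D0 D1 D2 D3 [D4 D5 D6]]] : exists2 d, 0 < d &
    [/\ d < d0, d < d1, d < d2, d < d3 & [/\ d < d4, d < d5 & d < d6]].
  exists ((\big[Num.min/d0]_(t <- [:: d1; d2; d3; d4; d5; d6]) t) / 2).
    by rewrite !big_cons big_nil divr_gt0// !lt_min d10 d20 d30 d40 d50 d60.
  set m := \big[_/_]_(_ <- _) _.
  have m0 : 0 < m by rewrite /m !big_cons big_nil !lt_min d10 d20 d30 d40 d50 d60.
  have m2 : m / 2 < m by lra.
  by do ![split]; apply: (lt_le_trans m2); rewrite /m !big_cons big_nil !ge_min lexx ?orbT.
have ctr : contracting d := contracting_le (ltW D0) ctr0.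
set Ca := `|a p| + 1 in H1; set Ca' := `|a' p| + 1 in H2.
set Cw := `|w p| + 1 in H3; set Cv := `|v p| + 1 in H4.
have [Ca0 Ca'0 Cw0 Cv0] : [/\ 0 < Ca, 0 < Ca', 0 < Cw & 0 < Cv].
  by split; exact: ltr_wpDl.
clearbody Ca Ca' Cw Cv; have B0 : 0 < B.
  have [|_ [/(_ 0%N) + _]] := H5 p; first by rewrite subrr normr0.
  by rewrite /orbit_prod big_ord0 normr1 => /(lt_le_trans ltr01).
pose C := Ca * Cv + Cw + Ca' + 1.
have C0 : 0 < C by rewrite /C !addr_gt0// mulr_gt0.
apply/nearP; exists d => // x xd; apply/is_derive_distP => eps eps0.
pose eps1 := eps * (1 - kap) / (B * C).
have eps10 : 0 < eps1 by rewrite /eps1 divr_gt0 ?mulr_gt0 ?subr_gt0.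
have [y yd|y yd|ea ea0 Ha] := @C1_uniform_littleo R a a' p d _ _ eps1 eps10.
- by have [[]] := H6 y (le_lt_trans yd D6).
- by have [] := H2 y (le_lt_trans yd D2).
have [y yd|y yd|eb eb0 Hb] := @C1_uniform_littleo R b b' p d _ _ eps1 eps10.
- by have [[]] := H6 y (le_lt_trans yd D6).
- by have [_ []] := H5 y (le_lt_trans yd D5).
have [y yd|y yd|eg eg0 Hg] := @C1_uniform_littleo R G G' p d _ _ eps1 eps10.
- by have [_ []] := H6 y (le_lt_trans yd D6).
- by have [_ []] := H6 y (le_lt_trans yd D6).
have [y|ew ew0 Hw] := @uniformly_continuous_segment R w (p - d) (p + d) _ eps1 eps10.
  rewrite -ball_segment => yd; have [] // := H3 y; exact: le_lt_trans D3.
have [del del0 [La Lb Lg Lw Ld]] : exists2 del, 0 < del &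
    [/\ del <= ea, del <= eb, del <= eg, del <= ew & del <= d - `|x - p|].
  exists (\big[Num.min/d - `|x - p|]_(t <- [:: ea; eb; eg; ew]) t).
    by rewrite !big_cons big_nil !lt_min ea0 eb0 eg0 ew0 subr_gt0.
  by split; rewrite !big_cons big_nil !ge_min lexx ?orbT.
exists del => // y yx.
have yd : `|y - p| < d by apply: ball_trans (lt_le_trans yx Ld).
pose E u z := `|w z - w u - v u * (z - u)|.
have step u z : `|u - p| < d -> `|z - p| < d -> `|z - u| < del ->
    E u z <= `|a u| * E (G u) (G z) + C * eps1 * `|z - u|.
  move=> ud zd zu; rewrite /E.
  have [_ Gud] := contracting_ball ctr ud; have [_ Gzd] := contracting_ball ctr zd.
  have [[wu vu] _] := H5 u (lt_trans ud D5); have [[wz _] _] := H5 z (lt_trans zd D5).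
  rewrite {1}wz {1}wu {1}vu.
  (* Each term in the second group carries one of the small factors: an expansion error
     of [a], [b] or [G], or an increment of [w]. *)
  have -> : b z + a z * w (G z) - (b u + a u * w (G u)) -
      (a' u * w (G u) + b' u + a u * G' u * v (G u)) * (z - u) =
    a u * (w (G z) - w (G u) - v (G u) * (G z - G u)) +
    (a u * v (G u) * (G z - G u - G' u * (z - u)) +
     (a z - a u - a' u * (z - u)) * w (G z) +
     a' u * (z - u) * (w (G z) - w (G u)) +
     (b z - b u - b' u * (z - u))) by ring.
  apply: (le_trans (ler_normD _ _)); rewrite normrM lerD2l.
  have [_ bau] := H1 u (lt_trans ud D1); have [_ bau'] := H2 u (lt_trans ud D2).
  have [_ bwz] := H3 _ (lt_trans Gzd D3); have [_ bvu] := H4 _ (lt_trans Gud D4).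
  have Gzu : `|G z - G u| < ew.
    apply: le_lt_trans (ctr _ _ zd ud) _; apply: lt_le_trans Lw.
    by apply: le_lt_trans zu; rewrite -[leRHS]mul1r ler_wpM2r// ltW.
  have t1 : `|a u * v (G u) * (G z - G u - G' u * (z - u))| <=
      Ca * Cv * (eps1 * `|z - u|).
    rewrite !normrM ler_pM ?mulr_ge0// ?ler_pM//.
    by apply: Hg => //; exact: lt_le_trans Lg.
  have t2 : `|(a z - a u - a' u * (z - u)) * w (G z)| <= eps1 * `|z - u| * Cw.
    rewrite normrM ler_pM//.
    by apply: Ha => //; exact: lt_le_trans La.
  have t3 : `|a' u * (z - u) * (w (G z) - w (G u))| <= Ca' * `|z - u| * eps1.
    rewrite !normrM ler_pM ?mulr_ge0// ?ler_pM//.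
    by apply/ltW/Hw => //; rewrite -ball_segment ltW.
  have t4 : `|b z - b u - b' u * (z - u)| <= eps1 * `|z - u|.
    by apply: Hb => //; exact: lt_le_trans Lb.
  have -> : C * eps1 * `|z - u| = Ca * Cv * (eps1 * `|z - u|) +
      eps1 * `|z - u| * Cw + Ca' * `|z - u| * eps1 + eps1 * `|z - u|.
    by rewrite /C; ring.
  by do 3![apply: le_trans (ler_normD _ _) _; apply: lerD => //].
have itd k : [/\ `|iter k G x - p| < d, `|iter k G y - p| < d &
    `|iter k G y - iter k G x| <= kap ^+ k * `|y - x|].
  by split; [exact: iter_ball|exact: iter_ball|exact: (@iter_contract d)].
have kle k : kap ^+ k * `|y - x| <= `|y - x|.
  by rewrite -[leRHS]mul1r ler_wpM2r// exprn_ile1// ltW.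
have := @unroll_bound R (fun k => E (iter k G x) (iter k G y))
  (fun k => `|a (iter k G x)|) B (C * eps1 * `|y - x|) kap.
move=> /(_ _ _ _ _ _ _) H.
apply: (@le_trans _ _ (B * (C * eps1 * `|y - x|) / (1 - kap))).
  apply: H => //.
  - by apply: mulr_ge0 => //; apply: mulr_ge0; exact: ltW.
  - by apply/andP; split => //; exact: ltW.
  - move=> k; have [_ [/(_ k) + _]] := H5 x (lt_trans xd D5).
    by rewrite /orbit_prod normr_prod.
  - move=> k; have [ud zd zu] := itd k.
    apply: le_trans (step _ _ ud zd _) _.
      by apply: le_lt_trans zu (le_lt_trans (kle k) yx).
    rewrite /= lerD2l -[leRHS]mulrA; apply: ler_wpM2l.
      by apply: mulr_ge0; exact: ltW.
    by rewrite mulrC.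
  - move=> e e0.
    have e1 : 0 < e / (1 + Cv) by rewrite divr_gt0// addr_gt0.
    have [|k [Hk1 Hk2]] := iter_eventually_ball (w := w) ctr _ yd xd e1.
      by have [] := H3 p; rewrite ?subrr ?normr0.
    exists k; have [ud _ _] := itd k.
    have [_ bvu] := H4 _ (lt_trans ud D4).
    apply: le_lt_trans (ler_normB _ _) _; rewrite normrM.
    have : `|v (iter k G x)| * `|iter k G y - iter k G x| <= Cv * (e / (1 + Cv)).
      by rewrite ler_pM// ltW.
    have ee : e = e / (1 + Cv) + Cv * (e / (1 + Cv)).
      by field; rewrite gt_eqF// addr_gt0.
    by move=> Hvk; rewrite [ltRHS]ee; exact: ltr_leD.
rewrite /eps1 le_eqVlt; apply/orP; left; apply/eqP; field.
by rewrite !gt_eqF// subr_gt0.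
Qed.

End Contraction.

(** * Bootstrapping the regularity of solutions *)

Section Bootstrap.
Context {R : realType}.
Implicit Types (w a b : R -> R).
Variables (om nu G G' : R -> R) (p kap : R).
Hypothesis mo : modulus om nu.
Hypothesis om_dich : nu kap < 1 \/ (forall t, 0 <= t -> om t = 1).
Hypothesis Gp : G p = p.
Hypothesis kap01 : 0 < kap < 1.
Hypothesis dG : \forall y \near p, is_derive (y : R) 1 G (G' y).
Hypothesis cG' : \forall y \near p, {for y, continuous G'}.
Hypothesis bG' : \forall y \near p, `|G' y| <= kap.

Lemma om_contract (s t : R) : 0 <= s -> s <= kap * t -> t <= 1 ->
  om s <= nu kap * om t.
Proof.
move=> s0 st t1; case/andP: kap01 => k0 k1.
have t0 : 0 <= t by rewrite -(pmulr_rge0 _ k0); exact: le_trans st.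
have [tz|tnz] := eqVneq t 0.
  have -> : s = kap * t by apply/eqP; rewrite eq_le st tz mulr0.
  by apply: (om_nu mo); rewrite ?t0// ltW.
have tp : 0 < t by rewrite lt_neqAle eq_sym tnz.
rewrite -{1}(divfK tnz s); apply: le_trans (om_nu mo _ _) _.
- by rewrite t0.
- by rewrite divr_ge0.
rewrite ler_wpM2r ?(om_ge0 mo)// (nu_mono mo)// ?divr_ge0//.
by rewrite ler_pdivrMr.
Qed.

(** Order zero of the bootstrap. Under the contraction the modulus decays geometrically,
    hence the increments of [a] and [b] along two orbits are summable; a constant modulus
    asks for boundedness only. *)
Lemma om_near_solution a b w :
  (\forall y \near p, {for y, continuous w}) ->
  (\forall y \near p, w y = b y + a y * w (G y)) ->
  bounded_orbit_prods G p a ->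
  om_near om a p -> om_near om b p -> om_near om w p.
Proof.
move=> cw weq [B bnd] [C1 C10 oa] [C2 C20 ob].
case/andP: (kap01) => k0 k1.
have {cw} [d3 d30 H3] := (nearP _ _).1 (continuous_near_bounded cw).
set Cw := `|w p| + 1 in H3; have Cw0 : 0 <= Cw by rewrite addr_ge0.
have [om1|om1] := om_dich; last first.
  exists (Cw + Cw); first exact: addr_ge0.
  apply/near2P; exists d3 => // y z /H3[_ wy] /H3[_ wz] /=.
  rewrite om1// mulr1; apply: le_trans (ler_normB _ _) _; exact: lerD.
have nk0 : 0 <= nu kap by apply: (nu_ge0 mo); exact: ltW.
have [d0 d00 ctr0] := contracting_near dG bG'.
have [d1 d10 H1] := (near2P _ _).1 (filterI oa ob).
have [d5 d50 H5] := (nearP _ _).1 (filterI weq bnd).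
have [d d_gt0 [D0 D1 D3 D5 D]] : exists2 d, 0 < d &
    [/\ d <= d0, d <= d1, d <= d3, d <= d5 & d <= 2^-1].
  exists (\big[Num.min/d0]_(t <- [:: d1; d3; d5; 2^-1]) t).
    by rewrite !big_cons big_nil !lt_min d10 d30 d50 d00 invr_gt0 ltr0n.
  by split; rewrite !big_cons big_nil !ge_min lexx ?orbT.
have ctr : contracting G p kap d := contracting_le D0 ctr0.
pose C := C1 * Cw + C2.
have C0 : 0 <= C by rewrite addr_ge0// mulr_ge0.
have B0 : 0 <= B.
  by have [|_ /(_ 0%N)] := H5 p; rewrite ?subrr ?normr0//; exact: le_trans.
exists (B * C / (1 - nu kap)).
  by rewrite divr_ge0 ?subr_ge0 ?mulr_ge0// ltW.
apply/near2P; exists d => // y z yd zd /=.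
have step u v : `|u - p| < d -> `|v - p| < d ->
    `|w u - w v| <= `|a u| * `|w (G u) - w (G v)| + C * om `|u - v|.
  move=> ud vd; have [_ Gvd] := contracting_ball Gp kap01 ctr vd.
  have [wu _] := H5 u (lt_le_trans ud D5); have [wv _] := H5 v (lt_le_trans vd D5).
  have [oau obu] := H1 u v (lt_le_trans ud D1) (lt_le_trans vd D1).
  have [_ bwv] := H3 _ (lt_le_trans Gvd D3).
  rewrite {1}wu {1}wv.
  have -> : b u + a u * w (G u) - (b v + a v * w (G v)) =
    a u * (w (G u) - w (G v)) + ((a u - a v) * w (G v) + (b u - b v)) by ring.
  apply: (le_trans (ler_normD _ _)); rewrite normrM lerD2l.
  apply: (le_trans (ler_normD _ _)); rewrite normrM /C mulrDl lerD// mulrAC.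
  exact: ler_pM.
have itd k : [/\ `|iter k G y - p| < d, `|iter k G z - p| < d &
    om `|iter k G y - iter k G z| <= nu kap ^+ k * om `|y - z|].
  have yk j := iter_ball Gp kap01 j ctr yd; have zk j := iter_ball Gp kap01 j ctr zd.
  split=> //; elim: k => [|k IH]; first by rewrite mul1r.
  rewrite exprS -mulrA; apply: le_trans (om_contract (normr_ge0 _) _ _) _.
  - exact: (ctr (iter k G y) (iter k G z)).
  - apply: (le_trans (ler_distD p _ _)); rewrite (distrC p) (splitr 1) div1r.
    by apply: lerD; apply/ltW/(lt_le_trans _ D).
  by rewrite ler_wpM2l.
have := @unroll_bound R (fun k => `|w (iter k G y) - w (iter k G z)|)
  (fun k => `|a (iter k G y)|) B (C * om `|y - z|) (nu kap).
move=> /(_ _ _ _ _ _ _) H.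
apply: (@le_trans _ _ (B * (C * om `|y - z|) / (1 - nu kap))); last first.
  by rewrite mulrA mulrAC.
apply: H => //.
- by apply: mulr_ge0 => //; exact: (om_ge0 mo).
- by rewrite nk0.
- move=> k; have [_ /(_ k)] := H5 y (lt_le_trans yd D5).
  by rewrite /orbit_prod normr_prod.
- move=> k; have [ud zd' zu] := itd k.
  apply: le_trans (step _ _ ud zd') _.
  by rewrite /= lerD2l -mulrA ler_wpM2l// mulrC.
- move=> e e0; have [|k [Hk _]] := iter_eventually_ball Gp kap01 (w := w) ctr _ yd zd e0.
    by have [] := H3 p; rewrite ?subrr ?normr0.
  by exists k.
Qed.

(** Induction on the order. The derivative of [w] is the solution of the differentiated
    equation, whose multiplier [a * G'] has bounded orbit products again, and whose
    inhomogeneous term involves [w] only through its regularity of one order less. *)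
Theorem bootstrap s a b w :
  Reg om s a p -> Reg om s b p -> Reg om s G' p ->
  (\forall y \near p, {for y, continuous w}) ->
  (\forall y \near p, w y = b y + a y * w (G y)) ->
  bounded_orbit_prods G p a -> Reg om s w p.
Proof.
elim: s a b w => [|s IH] a b w ra rb rG cw weq bp.
  split=> //; case: ra => _ oa; case: rb => _ ob.
  exact: om_near_solution weq bp oa ob.
have rw : Reg om s w p.
  by apply: IH weq bp; [exact: (RegS mo ra)|exact: (RegS mo rb)|exact: (RegS mo rG)|].
have rG0 : Reg om (maxn s 1) G p.
  have rG2 : Reg om s.+2 G p by exists G'.
  apply: (Reg_le mo) rG2.
  by rewrite geq_max (leq_trans (leqnSn s) (leqnSn _)).
have [a' da ra'] := ra; have [b' db rb'] := rb.
pose A y := a y * G' y; pose c y := a' y * w (G y) + b' y.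
have rA : Reg om s A p by apply: (RegM mo); exact: (RegS mo).
have rc : Reg om s c p.
  apply: RegD => //; apply: (RegM mo) => //.
  by apply: (Reg_comp mo) rG0; rewrite Gp.
have cA := Reg_continuous rA; have cc := Reg_continuous rc.
have [B bnd] := bp; case/andP: (kap01) => k0 k1.
have [d0 d00 ctr0] := contracting_near dG bG'.
have bA : \forall y \near p, forall k, `|orbit_prod G A k y| <= B * kap ^+ k.
  have [d1 d10 H1] := (nearP _ _).1 (filterI bnd bG').
  apply/nearP; exists (Num.min d0 d1); first by rewrite lt_min d00.
  have ctr : contracting G p kap (Num.min d0 d1).
    by apply: contracting_le ctr0; rewrite ge_min lexx.
  move=> y yd k; rewrite /orbit_prod big_split /= normrM.
  have [/(_ k) By _] : (forall k, `|orbit_prod G a k y| <= B) /\ `|G' y| <= kap.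
    by apply: H1; move: yd; rewrite lt_min => /andP[].
  apply: ler_pM => //; rewrite normr_prod.
  rewrite -[in leRHS](card_ord k) -prodr_const; apply: ler_prod => i _.
  rewrite normr_ge0 /=.
  have := iter_ball Gp kap01 i ctr yd; rewrite lt_min => /andP[_ /H1[]//].
have bAp : bounded_orbit_prods G p A.
  exists B; apply: filterS bA => y + k => /(_ k) /le_trans; apply.
  have B0 : 0 <= B.
    have [d Hd /(_ p)] := (nearP _ _).1 bnd; rewrite subrr normr0.
    by move=> /(_ Hd 0%N); exact: le_trans.
  by rewrite -[leRHS]mulr1 ler_wpM2l// exprn_ile1// ltW.
have [v [cv veq _]] : exists v, [/\ \forall y \near p, {for y, continuous v},
    \forall y \near p, v y = c y + A y * v (G y) & c p = 0 -> v p = 0].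
  have k01 : 0 <= kap < 1 by rewrite ltW.
  apply: (cohomological_solution Gp kap01 dG bG' k01 cA cc (M := B * (`|c p| + 1))).
  have [d1 d10 H1] := (nearP _ _).1 (filterI bA (continuous_near_bounded cc)).
  apply/nearP; exists (Num.min d0 d1); first by rewrite lt_min d00.
  have ctr : contracting G p kap (Num.min d0 d1).
    by apply: contracting_le ctr0; rewrite ge_min lexx.
  move=> y yd k; rewrite normrM mulrAC; apply: ler_pM => //.
    by move: yd; rewrite lt_min => /andP[_ /H1[]].
  have := iter_ball Gp kap01 k ctr yd; rewrite lt_min => /andP[_ /H1[_ []]//].
have dw : \forall y \near p, is_derive (y : R) 1 w (v y).
  apply: (C1_solution Gp kap01 dG cG' bG' da db) weq bp cv veq => //.
    exact: Reg_continuous ra'.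
  exact: Reg_continuous rb'.
exists v => //; apply: IH veq bAp => //; exact: (RegS mo).
Qed.

End Bootstrap.

(** * Primitives and logarithms *)

Section Antiderivative.
Context {R : realType}.

Lemma antiderivative (g : R -> R) (p d : R) : 0 < d ->
  (forall y, `|y - p| <= d -> {for y, continuous g}) ->
  exists h : R -> R, forall y, `|y - p| < d -> is_derive y 1 h (g y).
Proof.
move=> d0 cg; pose a := p - d; pose u := p + d.
have au : a < u by rewrite /a /u; lra.
have cgw : {within `[a, u], continuous g}.
  apply: continuous_in_subspaceT => y; rewrite inE /= in_itv /= => yau.
  by apply: cg; move: yau; rewrite /a /u ler_norml; lra.
have ig : lebesgue_measure.-integrable `[a, u] (EFin \o g).
  by apply: continuous_compact_integrable => //; exact: segment_compact.
pose h y := (\int[lebesgue_measure]_(t in `[a, y]) g t)%R.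
exists h => y yd.
have yu : y < u by move: yd; rewrite /u ltr_norml; lra.
have ay : a < y by move: yd; rewrite /a ltr_norml; lra.
have [dh hE] : derivable h y 1 /\ h^`()%classic y = g y.
  apply: (continuous_FTC1 yu ig); first by rewrite lte_fin.
  by apply: cg; exact: ltW.
by apply: DeriveDef; [exact: dh|rewrite -derive1E; exact: hE].
Qed.

Lemma ln_le_sub1 (x : R) : 0 < x -> ln x <= x - 1.
Proof. by move=> x0; have := expR_ge1Dx (ln x); rewrite lnK ?posrE//; lra. Qed.

Lemma ln_near1 (x : R) : `|x - 1| <= 2^-1 -> `|ln x| <= 2 * `|x - 1|.
Proof.
rewrite ler_norml => /andP[x1 x2]; have x0 : 0 < x by lra.
have H1 := ln_le_sub1 x0.
have := ln_le_sub1 (x := x^-1); rewrite invr_gt0 lnV ?posrE// => /(_ x0) H2.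
have E : x^-1 - 1 = (1 - x) / x by field; rewrite gt_eqF.
have xi2 : x^-1 <= 2 by rewrite -[leRHS]invrK lef_pV2 ?posrE//; lra.
have xi0 : 0 < x^-1 by rewrite invr_gt0.
have [xl|xg] := leP x 1.
  have : (1 - x) / x <= (1 - x) * 2 by rewrite ler_wpM2l// subr_ge0.
  rewrite E in H2; move: H2; move: ((1 - x) / x) => z H2 H3.
  by rewrite (ler0_norm (_ : ln x <= 0)) 1?(ler0_norm (_ : x - 1 <= 0)); lra.
have l0 : 0 <= ln x by rewrite ln_ge0// ltW.
by rewrite (ger0_norm l0) gtr0_norm; lra.
Qed.

Lemma Reg_derive1 (om : R -> R) s (g : R -> R) x : Reg om s.+1 g x ->
  (\forall y \near x, is_derive (y : R) 1 g (g^`()%classic y)) /\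
  Reg om s (g^`()%classic) x.
Proof.
move=> [g' dg rg']; split.
  by apply: filterS dg => y dgy; rewrite derive1E; apply: DeriveDef => //; case: dgy.
apply: Reg_eq rg'; apply: filterS dg => y dgy.
by rewrite derive1E; apply/esym; exact: derive_val.
Qed.

End Antiderivative.

(** * The conjugacy of an affine action *)

Section AffineAction.
Context {R : realType}.
Implicit Types (g h : R -> R) (a b s t x y : R).
Variables (n : nat).

Definition nadic t := exists (j : int) (l : nat), t = j%:~R / n%:R ^+ l.
Definition nscale a := exists k : nat, a = n%:R ^+ k \/ a = (n%:R ^+ k)^-1.

Variables (r : nat) (om nu e f : R -> R) (E : R -> R -> R -> R).
Hypothesis n_ge2 : (2 <= n)%N.
Hypothesis mo : modulus om nu.
Hypothesis om_dich : (forall t, 0 < t < 1 -> nu t < 1) \/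
  (forall t, 0 <= t -> om t = 1) /\ (0 < r)%N.
Hypothesis e_lt : forall s t, s < t -> e s < e t.
Hypothesis e01 : forall s, 0 < e s < 1.
Hypothesis e_cont : forall s, {for s, continuous e}.
Hypothesis fe : forall s, f (e s) = s.
Hypothesis ef : forall x, 0 < x < 1 -> e (f x) = x.
Hypothesis Ee : forall a t s, nscale a -> nadic t -> E a t (e s) = e (a * s + t).
Hypothesis E_reg : forall a t x, nscale a -> nadic t -> 0 < x < 1 ->
  Reg om r.+1 (E a t) x.
Hypothesis E_end : forall a t, nscale a -> nadic t ->
  exists c, strict_deriv (E a t) 1 c.

Let N : R := n%:R.
Let N0 : 0 < N. Proof. by rewrite ltr0n; case: n n_ge2. Qed.
Let N1 : 1 < N. Proof. by rewrite ltr1n. Qed.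
Let N2 : 2 <= N. Proof. by rewrite (ler_nat R 2). Qed.

Lemma nadic_nat (j : nat) : nadic j%:R.
Proof. by exists j, 0%N; rewrite expr0 divr1. Qed.

Lemma nadic0 : nadic 0. Proof. exact: nadic_nat 0%N. Qed.

Lemma nadicD s t : nadic s -> nadic t -> nadic (s + t).
Proof.
move=> [i [k ->]] [j [l ->]].
exists (i * (n ^ l)%N%:Z + j * (n ^ k)%N%:Z)%R, (k + l)%N.
rewrite rmorphD /= !rmorphM /= -!pmulrn !natrX exprD -/N.
by field; rewrite !expf_neq0 ?gt_eqF.
Qed.

Lemma nadicN t : nadic t -> nadic (- t).
Proof. by move=> [j [l ->]]; exists (- j), l; rewrite rmorphN mulNr. Qed.

Lemma nadicM s t : nadic s -> nadic t -> nadic (s * t).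
Proof.
move=> [i [k ->]] [j [l ->]]; exists (i * j), (k + l)%N.
rewrite rmorphM /= exprD -/N.
by field; rewrite !expf_neq0 ?gt_eqF.
Qed.

Lemma nadic_scale a : nscale a -> nadic a.
Proof.
move=> [k [->|->]]; first by rewrite -natrX; exact: nadic_nat.
by exists 1, k; rewrite mul1r.
Qed.

Lemma nscale_gt0 a : nscale a -> 0 < a.
Proof. by move=> [k [->|->]]; rewrite ?invr_gt0 exprn_gt0. Qed.

Lemma nscaleV a : nscale a -> nscale a^-1.
Proof. by move=> [k [->|->]]; exists k; [right|left; rewrite invrK]. Qed.

Lemma nscale1 : nscale 1. Proof. by exists 0%N; left. Qed.

Lemma nscaleX k : nscale (N ^+ k). Proof. by exists k; left. Qed.

Lemma nadic_dense s eps m : 0 < eps -> exists (j : int) (l : nat),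
  (m <= l)%N /\ `|j%:~R / N ^+ l - s| < eps.
Proof.
move=> eps0.
have [|M HM] := @expr_small R N^-1 1 eps _ ler01 eps0.
  by rewrite invr_ge0 ltW//= invf_lt1.
pose l := maxn m M; exists (Num.floor (s * N ^+ l)), l.
split; first exact: leq_maxl.
have := HM l (leq_maxr _ _); rewrite mulr1 exprVn; apply: le_lt_trans.
have p0 : 0 < N ^+ l by rewrite exprn_gt0.
rewrite -[leRHS]mul1r ler_pdivlMr// -[X in _ * X <= _](gtr0_norm p0) -normrM.
rewrite mulrBl divfK ?gt_eqF//.
have := floor_le_tmp (s * N ^+ l); have := floorD1_gt (s * N ^+ l).
rewrite intrD ler_norml; lra.
Qed.

Lemma f_between s t x : e s < x < e t -> s < f x < t.
Proof.
move=> /andP[sx xt].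
have x01 : 0 < x < 1 by have := e01 s; have := e01 t; lra.
have le_of u v : e u < e v -> u < v.
  by move=> uv; rewrite ltNge; apply/negP => /(e_le e_lt); lra.
by apply/andP; split; apply: le_of; rewrite ef.
Qed.

(** [e] is continuous and open. *)
Lemma near_e (P : set R) s0 :
  (\forall x \near e s0, P x) <-> (\forall s \near s0, P (e s)).
Proof.
split=> [Px|/nearP[d d0 H]]; first exact: e_cont Px.
have e1 : e (s0 - d / 2) < e s0 by apply: e_lt; lra.
have e2 : e s0 < e (s0 + d / 2) by apply: e_lt; lra.
apply/nearP; exists (Num.min (e s0 - e (s0 - d / 2)) (e (s0 + d / 2) - e s0)).
  by rewrite lt_min !subr_gt0 e1.
move=> x; rewrite lt_min !ltr_norml => xe.
have /f_between fx : e (s0 - d / 2) < x < e (s0 + d / 2) by lra.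
rewrite -(ef (x := x)); first by apply: H; rewrite ltr_norml; lra.
by have := e01 (s0 - d / 2); have := e01 (s0 + d / 2); lra.
Qed.

Lemma e_to1 x : x < 1 -> exists s, x < e s.
Proof.
move=> x1; exists (f ((Num.max x 0 + 1) / 2)).
have m1 : x <= Num.max x 0 by rewrite le_max lexx.
have m0 : 0 <= Num.max x 0 by rewrite le_max lexx orbT.
have m2 : Num.max x 0 < 1 by rewrite gt_max x1 ltr01.
by rewrite ef; lra.
Qed.

Definition dE a t : R -> R := (E a t)^`()%classic.

Lemma dE_near a t s : nscale a -> nadic t ->
  (\forall y \near e s, is_derive (y : R) 1 (E a t) (dE a t y)) /\
  Reg om r (dE a t) (e s).
Proof. by move=> ha ht; apply: Reg_derive1; exact: E_reg. Qed.

Lemma dE_deriv a t s : nscale a -> nadic t -> is_derive (e s) 1 (E a t) (dE a t (e s)).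
Proof. by move=> ha ht; case: (dE_near s ha ht) => /nbhs_singleton. Qed.

Lemma dE_cont a t s : nscale a -> nadic t -> \forall y \near e s, {for y, continuous (dE a t)}.
Proof. by move=> ha ht; case: (dE_near s ha ht) => _ /Reg_continuous. Qed.

Lemma dE_strict a t s : nscale a -> nadic t -> strict_deriv (E a t) (e s) (dE a t (e s)).
Proof.
move=> ha ht; case: (dE_near s ha ht) => dg rg.
by apply: C1_strict_deriv dg _; exact: (nbhs_singleton (dE_cont s ha ht)).
Qed.

Lemma is_derive_unique g x c c' : is_derive x 1 g c -> is_derive x 1 g c' -> c = c'.
Proof. by move=> [_ <-] [_ <-]. Qed.

(** Chain rule in the group of affine maps. *)
Lemma dE_comp a b s t u : nscale a -> nscale b -> nscale (a * b) ->
  nadic s -> nadic t ->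
  dE a s (E b t (e u)) * dE b t (e u) = dE (a * b) (a * t + s) (e u).
Proof.
move=> ha hb hab hs ht.
have hn : nadic (a * t + s) by apply: nadicD => //; apply: nadicM => //; exact: nadic_scale.
apply: is_derive_unique (dE_deriv u hab hn).
have H : is_derive (e u) 1 (E a s \o E b t) (dE a s (E b t (e u)) * dE b t (e u)).
  by apply: is_derive1_comp; [rewrite Ee//; exact: dE_deriv|exact: dE_deriv].
apply: near_eq_is_derive H; apply/near_e; apply: filterE => v /=.
by rewrite !Ee//; congr e; ring.
Qed.

Lemma dE_id s : dE 1 0 (e s) = 1.
Proof.
apply: is_derive_unique (dE_deriv s nscale1 nadic0) _.
have H : is_derive (e s) 1 id (1 : R) by exact: is_derive_id.
apply: near_eq_is_derive H; apply/near_e; apply: filterE => v /=; rewrite Ee ?mul1r ?addr0//.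
  exact: nscale1.
exact: nadic0.
Qed.

Lemma E_inv a t s : nscale a -> nadic t -> E a^-1 (- t / a) (E a t (e s)) = e s.
Proof.
move=> ha ht; have a0 := nscale_gt0 ha; have ha' := nscaleV ha.
have ht' : nadic (- t / a) by apply: nadicM; [exact: nadicN|exact: nadic_scale].
by rewrite !Ee//; congr e; field; rewrite gt_eqF.
Qed.

Lemma dE_gt0 a t s : nscale a -> nadic t -> 0 < dE a t (e s).
Proof.
move=> ha ht; have a0 := nscale_gt0 ha; have ha' := nscaleV ha.
have ht' : nadic (- t / a) by apply: nadicM; [exact: nadicN|exact: nadic_scale].
have ne0 : dE a t (e s) != 0.
  apply/eqP => d0.
  have h1 : nscale (a^-1 * a) by rewrite mulVf ?gt_eqF//; exact: nscale1.
  have := dE_comp s ha' ha h1 ht' ht; rewrite d0 mulr0.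
  have -> : a^-1 * t + - t / a = 0 by ring.
  by rewrite mulVf ?gt_eqF// dE_id => /eqP; rewrite eq_sym oner_eq0.
rewrite lt_neqAle eq_sym ne0 /= leNgt; apply/negP => dneg.
have /is_derive_distP/(_ (- dE a t (e s) / 2)) [|d d0 H] := dE_deriv s ha ht.
  by lra.
have /continuous_distP/(_ _ d0)[d' d'0 H'] := @e_cont s.
have : `|e (s + d' / 2) - e s| < d by apply: H'; rewrite addrAC subrr add0r gtr0_norm; lra.
have ss : e s < e (s + d' / 2) by apply: e_lt; lra.
move=> /H; have : E a t (e s) < E a t (e (s + d' / 2)).
  by rewrite !Ee// e_lt// ltrD2r ltr_pM2l//; lra.
have xx : 0 < e (s + d' / 2) - e s by lra.
rewrite (gtr0_norm xx) ler_norml; set X := e _ - e s in xx *.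
set c := dE a t (e s) in dneg *; move=> H1 /andP[_ H2].
have : c * X < 0 by rewrite nmulr_rlt0.
by move: H2; have -> : - c / 2 * X = - (c * X) / 2 by [ring]; lra.
Qed.

Lemma E_lim1 a t : nscale a -> nadic t ->
  (fun j => E a t (e j%:R)) @ \oo --> (1 : R).
Proof.
move=> ha ht; have a0 := nscale_gt0 ha; under eq_fun do rewrite Ee//.
apply: (e_lim1 e_lt e01 e_to1) => A; have [M HM] := tends_infty_nat ((A - t) / a).
exists M => k /HM; rewrite ler_pdivrMr//; lra.
Qed.

Lemma E_end_neq0 a t c : nscale a -> nadic t -> strict_deriv (E a t) 1 c -> c != 0.
Proof.
move=> ha ht dc; have a0 := nscale_gt0 ha; have ha' := nscaleV ha.
have ht' : nadic (- t / a) by apply: nadicM; [exact: nadicN|exact: nadic_scale].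
have [c' dc'] := E_end ha' ht'.
have e1 : (fun j => e j%:R) @ \oo --> (1 : R).
  by apply: (e_lim1 e_lt e01 e_to1); exact: tends_infty_nat.
have := @strict_deriv_inv R (E a t) (E a^-1 (- t / a)) 1 1 c c'
  (fun j => e j%:R) (fun j => e j.+1%:R) dc dc'.
move=> /(_ _ _ _ _ _ _ _ _ _ _ _) H; apply/eqP => c0.
have : c * c' = 1; last by rewrite c0 mul0r => /eqP; rewrite eq_sym oner_eq0.
apply: H => //.
- by move=> j; rewrite Ee.
- by move=> j; rewrite Ee.
- by move=> j; rewrite lt_eqF// e_lt// ltr_nat.
- by move=> j; exact: E_inv.
- by move=> j; exact: E_inv.
- by rewrite (cvg_shiftS (fun j => e j%:R)).
- exact: E_lim1.
- by have := E_lim1 ha ht; rewrite -(cvg_shiftS (fun j => E a t (e j%:R))).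
Qed.

(** Moving the fixed point [e q] to the origin gives an instance of [multiplier] for the
    expansion by [n ^ k]. *)
Lemma dE_homothety k t q : (0 < k)%N -> nadic t -> q = (N ^+ k)^-1 * q + t ->
  dE (N ^+ k)^-1 t (e q) = (N ^+ k)^-1.
Proof.
move=> k0 ht hq; have hk := nscaleX k; have hk' := nscaleV hk.
have p0 : 0 < N ^+ k by rewrite exprn_gt0.
(* The inverse of [s |-> n ^- k * s + t] is [s |-> n ^ k * s - n ^ k * t]. *)
have ht' : nadic (- N ^+ k * t).
  by apply: nadicM => //; apply: nadicN; exact: nadic_scale.
have [rho drho] := E_end hk ht'; have [tau dtau] := E_end nscale1 (nadic_nat 1).
pose e2 s := e (s + q).
have := @multiplier R (n ^ k)%N e2 (E (N ^+ k)^-1 t) (E (N ^+ k) (- N ^+ k * t))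
  (E 1 1) (dE (N ^+ k)^-1 t (e q)) rho tau.
rewrite !natrX -/N; move=> /(_ _ _ _ _ _ _ _ _ _ _ _ _ _ _ _) H; apply: H => //.
- case: k k0 {hk hk' p0 ht' drho hq} => // k _.
  by rewrite expnS (leq_trans n_ge2)// leq_pmulr// expn_gt0 (ltnW n_ge2).
- by move=> s u su; rewrite e_lt// ltrD2r.
- by move=> s; exact: e01.
- by move=> x /e_to1[s xs]; exists (s - q); rewrite /e2 subrK.
- rewrite /e2; apply: continuous_comp; last exact: e_cont.
  by apply: continuousD; [exact: cvg_id|exact: cvg_cst].
- move=> s; rewrite /e2 Ee//; congr e; rewrite mulrDr -addrA -hq; congr (_ + _).
  by rewrite mulrC.
- move=> s; rewrite /e2 Ee//; congr e; rewrite mulrDr {1}hq.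
  by field; rewrite gt_eqF.
- by move=> s; rewrite /e2 Ee// ?mul1r; [congr e; ring|exact: nscale1|exact: (nadic_nat 1)].
- by rewrite /e2 add0r; exact: dE_strict.
- by rewrite gt_eqF// dE_gt0.
- exact: (E_end_neq0 hk ht').
- exact: (E_end_neq0 nscale1 (nadic_nat 1)).
- move=> J; exists (E 1 J%:R), (dE 1 J%:R (e q)); split.
  + by rewrite gt_eqF// dE_gt0//; [exact: nscale1|exact: nadic_nat].
  + by rewrite /e2 add0r; apply: dE_strict; [exact: nscale1|exact: nadic_nat].
  + by move=> s; rewrite /e2 Ee ?mul1r; [congr e; ring|exact: nscale1|exact: nadic_nat].
Qed.

Let G := E N^-1 0.
Let G' := dE N^-1 0.
Let p := e 0.
Let kap : R := 3 / 4.

Lemma nscaleNV : nscale N^-1.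
Proof. by apply: nscaleV; rewrite -(expr1 N); exact: nscaleX. Qed.

Lemma GE s : G (e s) = e (s / N).
Proof. by rewrite /G Ee ?addr0 1?mulrC//; [exact: nscaleNV|exact: nadic0]. Qed.

Lemma Gp : G p = p. Proof. by rewrite /p GE mul0r. Qed.

Lemma G'p : G' p = N^-1.
Proof.
rewrite /G' /p; have := @dE_homothety 1 0 0 isT nadic0.
by rewrite !expr1 mulr0 addr0; apply.
Qed.

Lemma G'_gt0 s : 0 < G' (e s).
Proof. by apply: dE_gt0; [exact: nscaleNV|exact: nadic0]. Qed.

Lemma kap01 : 0 < kap < 1. Proof. by rewrite /kap; lra. Qed.

Lemma dG_near s : \forall y \near e s, is_derive (y : R) 1 G (G' y).
Proof. by case: (dE_near s nscaleNV nadic0). Qed.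

Lemma cG' s : \forall y \near e s, {for y, continuous G'}.
Proof. by apply: dE_cont; [exact: nscaleNV|exact: nadic0]. Qed.

Lemma bG' : \forall y \near p, `|G' y| <= kap.
Proof.
have /continuous_distP/(_ (4^-1)) [|d d0 H] := nbhs_singleton (cG' 0); first by lra.
apply/nearP; exists d => // y /H; rewrite -/p G'p.
have Ni : N^-1 <= 2^-1 by rewrite lef_pV2 ?posrE//; lra.
have Ni0 : 0 < N^-1 by rewrite invr_gt0.
by rewrite /kap ltr_norml ler_norml; lra.
Qed.

Lemma RegG' s : Reg om r G' (e s).
Proof. by case: (dE_near s nscaleNV nadic0). Qed.

(** Either the modulus itself decays along orbits, or it is constant and the additional
    derivative makes [G'] Lipschitz. *)
Lemma G'_decay : exists M q, [/\ 0 <= M, 0 <= q < 1 &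
  \forall y \near p, forall k, `|G' (iter k G y) - N^-1| <= M * q ^+ k].
Proof.
have k01 := kap01; case/andP: (kap01) => k0 k1.
have [d0 d00 ctr0] := contracting_near (dG_near 0) bG'.
have [hn|[om1 r0]] := om_dich.
  have [C C0 /near2P[d1 d10 H1]] : om_near om G' p.
    have [_] // : Reg om 0 G' p.
    by apply: (Reg_le mo) (RegG' 0).
  pose d := Num.min (Num.min d0 d1) 2^-1.
  have dd0 : d <= d0 by rewrite !ge_min lexx.
  have dd1 : d <= d1 by rewrite !ge_min lexx ?orbT.
  have d2 : d <= 2^-1 by rewrite ge_min lexx orbT.
  have dpos : 0 < d by rewrite !lt_min d00 d10 invr_gt0 ltr0n.
  clearbody d; have ctr := contracting_le dd0 ctr0.
  have nk0 : 0 <= nu kap by apply: (nu_ge0 mo); exact: ltW.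
  have om10 : 0 <= om 1 by exact: (om_ge0 mo).
  exists (C * (nu 1 * om 1)), (nu kap); split.
  - by rewrite !mulr_ge0// (nu_ge0 mo).
  - by rewrite nk0 hn.
  apply/nearP; exists d => // y yd k.
  have itk := iter_ball Gp k01 k ctr yd.
  have := H1 (iter k G y) p (lt_le_trans itk dd1); rewrite subrr normr0 /= G'p.
  move=> /(_ d10)/le_trans; apply; rewrite -mulrA ler_wpM2l//.
  elim: k {itk} => [|k IH] /=.
    rewrite mulr1 -{1}[`|y - p|]mulr1.
    apply: le_trans (om_nu mo _ _) _; rewrite ?ler01 ?lexx//.
    by rewrite ler_wpM2r// (nu_mono mo)//; lra.
  have itk := iter_ball Gp k01 k ctr yd.
  rewrite exprSr mulrA [leRHS]mulrC.
  apply: le_trans (om_contract mo k01 (t := `|iter k G y - p|) _ _ _) _ => //.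
  - by case: (contracting_ball Gp k01 ctr itk).
  - by lra.
  - by rewrite ler_wpM2l.
have rG1 : Reg om 1 G' p by apply: (Reg_le mo) (RegG' 0).
have [L L0 /near2P[d1 d10 H1]] := Reg_lip rG1.
pose d := Num.min d0 d1.
have dpos : 0 < d by rewrite lt_min d00.
have ctr : contracting G p kap d by apply: contracting_le ctr0; rewrite ge_min lexx.
exists (L * d), kap; split; [by rewrite mulr_ge0// ltW|by rewrite ltW|].
apply/nearP; exists d => // y yd k.
have itk := iter_ball Gp k01 k ctr yd.
have id1 : `|iter k G y - p| < d1 by move: itk; rewrite lt_min => /andP[].
have := H1 (iter k G y) p id1; rewrite subrr normr0 /= G'p.
move=> /(_ d10)/le_trans; apply; rewrite -mulrA ler_wpM2l//.
have := iter_contract Gp k01 k ctr yd (z := p); rewrite (iter_fix _ Gp) subrr normr0.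
move=> /(_ dpos)/le_trans; apply.
by rewrite mulrC ler_wpM2r ?exprn_ge0 ?ltW.
Qed.

(** [cohomological_solution] with [A = 1] and [c = ln (N * G')]: the series converges
    because [N * G' p = 1] and [G'] approaches its value at [p] geometrically. *)
Lemma potential : exists psi, [/\ \forall y \near p, {for y, continuous psi},
  \forall y \near p, expR (psi y) = N * G' y * expR (psi (G y)) & psi p = 0].
Proof.
have [M [q [M0 q01 Hd]]] := G'_decay.
pose u y := ln (N * G' y).
have cNG : \forall y \near p, {for y, continuous (fun y => N * G' y)}.
  by apply: filterS (cG' 0) => y cy; apply: continuousM cy; exact: cvg_cst.
have pos : \forall y \near p, 0 < N * G' y.
  by apply/near_e; apply: filterE => s; rewrite mulr_gt0// G'_gt0.
have cu : \forall y \near p, {for y, continuous u}.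
  apply: filterS2 cNG pos => y cy y0; apply: continuous_comp cy _.
  exact: continuous_ln.
have c1 : \forall y \near p, {for y, continuous (fun _ : R => 1 : R)}.
  by apply: filterE => y; exact: cvg_cst.
(* [ln] is bounded by a multiple of its argument minus one near [1] only, hence
   the smaller neighbourhood. *)
have small : \forall y \near p, `|N * G' y - 1| <= 2^-1.
  have /continuous_distP/(_ 2^-1) [|d d0 H] := nbhs_singleton cNG; first by lra.
  by apply/nearP; exists d => // y /H /ltW; rewrite G'p divff ?gt_eqF.
have [d0 d00 ctr0] := contracting_near (dG_near 0) bG'.
have bnd : \forall y \near p, forall k,
    `|orbit_prod G (fun _ => 1) k y * u (iter k G y)| <= 2 * N * M * q ^+ k.
  have [d1 d10 H1] := (nearP _ _).1 (filterI Hd small).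
  apply/nearP; exists (Num.min d0 d1); first by rewrite lt_min d00.
  have ctr : contracting G p kap (Num.min d0 d1).
    by apply: contracting_le ctr0; rewrite ge_min lexx.
  move=> y yd k; rewrite /orbit_prod big1 // mul1r.
  have := iter_ball Gp kap01 k ctr yd; rewrite lt_min => /andP[_ /H1[_ sm]].
  apply: (le_trans (ln_near1 sm)).
  have -> : N * G' (iter k G y) - 1 = N * (G' (iter k G y) - N^-1).
    by field; rewrite gt_eqF.
  rewrite normrM gtr0_norm// -!mulrA ler_pM2l// ler_pM2l//.
  by move: yd; rewrite lt_min => /andP[_ /H1[/(_ k)]].
have [psi [cpsi psieq psi0]] :=
  cohomological_solution Gp kap01 (dG_near 0) bG' q01 c1 cu bnd.
exists psi; split=> //; last by apply: psi0; rewrite /u G'p divff ?gt_eqF// ln1.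
apply: filterS2 psieq pos => y -> y0.
by rewrite mul1r expRD /u lnK.
Qed.

Section Straightening.
Variables (psi : R -> R) (eta : R).
Hypothesis eta0 : 0 < eta.
Hypothesis psi_cont : forall s, `|s| < eta -> {for e s, continuous psi}.
Hypothesis psi_eq : forall s, `|s| < eta ->
  expR (psi (e s)) = N * G' (e s) * expR (psi (e (s / N))).
Hypothesis psi0 : psi p = 0.

Let phi s := expR (psi (e s)).

Lemma phi_gt0 s : 0 < phi s. Proof. exact: expR_gt0. Qed.

Lemma phi_cont s : `|s| < eta -> {for s, continuous phi}.
Proof.
move=> se; apply: (continuous_comp (f := fun t => psi (e t))); last exact: continuous_expR.
by apply: continuous_comp; [exact: e_cont|exact: psi_cont].
Qed.

Lemma divX_lt s k : `|s| < eta -> `|s / N ^+ k| < eta.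
Proof.
apply: le_lt_trans; have p0 : 0 < N ^+ k by rewrite exprn_gt0.
rewrite normrM normfV (gtr0_norm p0) ler_pdivrMr// -[leLHS]mulr1 ler_wpM2l//.
by rewrite exprn_ege1// ltW.
Qed.

(** In the length element [phi] the powers of [G] are exact contractions. *)
Lemma dGk k s : `|s| < eta ->
  dE (N ^+ k)^-1 0 (e s) * phi (s / N ^+ k) * N ^+ k = phi s.
Proof.
elim: k s => [|k IH] s se.
  by rewrite expr0 invr1 !mulr1 dE_id mul1r.
have sN : `|s / N| < eta by have := divX_lt 1 se; rewrite expr1.
have := psi_eq se; rewrite -/(phi s) -/(phi (s / N)) => ->.
rewrite -(IH _ sN).
have -> : (N ^+ k.+1)^-1 = (N ^+ k)^-1 * N^-1 by rewrite exprSr invfM mulrC.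
have hk := nscaleV (nscaleX k).
have hk1 : nscale ((N ^+ k)^-1 * N^-1).
  by rewrite -invfM mulrC -exprS; exact: (nscaleV (nscaleX k.+1)).
have := dE_comp s hk nscaleNV hk1 nadic0 nadic0; rewrite mulr0 addr0 => <-.
rewrite -/G GE -/G' exprSr.
have -> : s / N / N ^+ k = s * ((N ^+ k)^-1 * N^-1) by rewrite -mulrA [N^-1 * _]mulrC.
by ring.
Qed.

Lemma continuous_seq g (x : R) (u : nat -> R) : {for x, continuous g} -> u @ \oo --> x ->
  (fun k => g (u k)) @ \oo --> g x.
Proof.
move=> /continuous_distP cg /seq_limP ux; apply/seq_limP => eps /cg[d d0 H].
by have [M HM] := ux _ d0; exists M => k /HM/H.
Qed.

Lemma seq_lim_abs_lt (u : nat -> R) (x d : R) : `|x| < d -> u @ \oo --> x ->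
  exists M, forall k, (M <= k)%N -> `|u k| < d.
Proof.
move=> xd /seq_limP/(_ (d - `|x|)) []; first by rewrite subr_gt0.
move=> M HM; exists M => k /HM H.
by have := ler_distD x (u k) 0; rewrite !subr0; lra.
Qed.

Lemma seq_lim_eventually (u v : nat -> R) (x : R) M :
  (forall k, (M <= k)%N -> u k = v k) -> u @ \oo --> x -> v @ \oo --> x.
Proof.
move=> uv /seq_limP ux; apply/seq_limP => eps /ux[K HK].
exists (maxn M K) => k; rewrite geq_max => /andP[Mk Kk].
by rewrite -uv// HK.
Qed.

Lemma NX_lim0 (c : R) : (fun k => c / N ^+ k) @ \oo --> (0 : R).
Proof.
have Ni : `|N^-1| < 1 by rewrite gtr0_norm ?invr_gt0// invf_lt1.
have : (fun k => c * N^-1 ^+ k) @ \oo --> c * 0.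
  by apply: seq_limM; [exact: cvg_cst|exact: cvg_expr].
by rewrite mulr0; under eq_fun do rewrite exprVn.
Qed.

(** Composed with a high power of [G], a short translation becomes a homothety whose
    multiplier is known and whose fixed point tends to [e t]. *)
Lemma dT_origin t : nadic t -> `|t| < eta -> dE 1 t p * phi t = 1.
Proof.
move=> ht te.
(* [e (q k)] is the fixed point of [E (n ^- k) t], and [q k] tends to [t]. *)
pose q k := t / (1 - (N ^+ k)^-1).
have qlim : q @ \oo --> t.
  have : (fun k => t * (1 - 1 / N ^+ k)^-1) @ \oo --> t * (1 - 0)^-1.
    apply: seq_limM (cvg_cst t) _; apply: seq_limV; first by rewrite subr0 oner_neq0.
    by apply: cvgB; [exact: cvg_cst|exact: NX_lim0].
  by rewrite subr0 invr1 mulr1; under eq_fun do rewrite mul1r.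
have qNlim : (fun k => q k / N ^+ k) @ \oo --> (0 : R).
  have := seq_limM qlim (NX_lim0 1); rewrite mulr0.
  by under eq_fun do rewrite mul1r.
have [M HM] := seq_lim_abs_lt te qlim.
have H k : (maxn 1 M <= k)%N ->
    dE 1 t (e (q k / N ^+ k)) * phi (q k) / phi (q k / N ^+ k) = 1.
  rewrite geq_max => /andP[k1 Mk]; have qe := HM _ Mk.
  have pN : 1 < N ^+ k by rewrite exprn_egt1// -lt0n.
  have pN0 : 0 < N ^+ k by lra.
  have hk := nscaleV (nscaleX k).
  have hq : q k = (N ^+ k)^-1 * q k + t.
    by rewrite /q; field; rewrite gt_eqF// subr_eq0 gt_eqF.
  have hk1 : nscale (1 * (N ^+ k)^-1) by rewrite mul1r.
  have := dE_comp (q k) nscale1 hk hk1 ht nadic0.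
  rewrite mul1r mulr0 add0r (dE_homothety k1 ht hq) Ee ?addr0//; last exact: nadic0.
  rewrite [_^-1 * q k]mulrC -(dGk k qe).
  have ph := phi_gt0 (q k / N ^+ k).
  set D := dE _ _ (e (q k)); set X := dE _ _ _ => XD.
  have -> : X * (D * phi (q k / N ^+ k) * N ^+ k) / phi (q k / N ^+ k) =
    X * D * N ^+ k by field; rewrite gt_eqF.
  by rewrite XD mulVf// gt_eqF.
have L : (fun k => dE 1 t (e (q k / N ^+ k)) * phi (q k) / phi (q k / N ^+ k))
    @ \oo --> dE 1 t (e 0) * phi t / phi 0.
  have z0 : `|0 : R| < eta by rewrite normr0.
  apply: seq_limM; last first.
    apply: seq_limV; first by rewrite gt_eqF// phi_gt0.
    exact: continuous_seq (phi_cont z0) qNlim.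
  apply: seq_limM; last exact: continuous_seq (phi_cont te) qlim.
  apply: continuous_seq; first exact: (nbhs_singleton (dE_cont 0 nscale1 ht)).
  exact: continuous_seq (@e_cont 0) qNlim.
have L1 : (fun k => dE 1 t (e (q k / N ^+ k)) * phi (q k) / phi (q k / N ^+ k))
    @ \oo --> (1 : R).
  apply: (seq_lim_eventually (u := fun=> 1) (M := maxn 1 M)); last exact: cvg_cst.
  by move=> k /H ->.
have phi00 : phi 0 = 1 by rewrite /phi -/p psi0 expR0.
by have := seq_lim_unique L L1; rewrite phi00 divr1.
Qed.

Lemma nadic_near s eps : 0 < eps -> exists2 t, nadic t & `|t - s| < eps.
Proof.
move=> eps0; have [j [l [_ jl]]] := nadic_dense s 0 eps0.
by exists (j%:~R / N ^+ l) => //; exists j, l.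
Qed.

(** Density of the [n]-adic rationals, applied to an identity. *)
Lemma nadic_eq (g : R -> R) (s d : R) : 0 < d -> {for s, continuous g} ->
  (forall t, nadic t -> `|t - s| < d -> g t = 0) -> g s = 0.
Proof.
move=> d0 /continuous_distP cg H; apply/eqP/negPn/negP => gs.
have [|d' d'0 H'] := cg `|g s|; first by rewrite normr_gt0.
have [|t ht] := nadic_near s (_ : 0 < Num.min d d'); first by rewrite lt_min d0.
rewrite lt_min => /andP[td td']; have := H' _ td'.
by rewrite H// sub0r normrN ltxx.
Qed.

(** The chain rule for [E 1 t] and [E 1 s] carries the identity at [p] to the points [e s]
    with [s] [n]-adic, and continuity to all points near [p]. *)
Lemma dT_local s t : nadic t -> `|s| < eta -> `|s + t| < eta ->
  dE 1 t (e s) * phi (s + t) = phi s.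
Proof.
move=> ht se ste.
pose g u := dE 1 t (e u) * phi (u + t) - phi u.
apply/eqP; rewrite -subr_eq0 -/(g s); apply/eqP.
pose d := Num.min (eta - `|s|) (eta - `|s + t|).
have d0 : 0 < d by rewrite lt_min !subr_gt0 se.
apply: (nadic_eq d0).
  apply: continuousB; last exact: phi_cont.
  apply: continuousM.
    apply: continuous_comp; first exact: e_cont.
    exact: (nbhs_singleton (dE_cont s nscale1 ht)).
  apply: (continuous_comp (f := fun u => u + t)); last exact: phi_cont.
  by apply: continuousD; [exact: cvg_id|exact: cvg_cst].
move=> u hu; rewrite lt_min => /andP[us ust].
have ue : `|u| < eta by have := ler_distD s u 0; rewrite !subr0; lra.
have ute : `|u + t| < eta.
  have := ler_distD (s + t) (u + t) 0; rewrite !subr0.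
  have -> : u + t - (s + t) = u - s by ring.
  by lra.
have h11 : nscale (1 * 1) by rewrite mulr1; exact: nscale1.
have := dE_comp 0 nscale1 nscale1 h11 ht hu.
rewrite Ee ?mulr0 ?add0r ?mul1r//; last exact: nscale1.
have := dT_origin hu ue; have hut : nadic (u + t) by exact: nadicD.
have := dT_origin hut ute; rewrite -/p => H1 H2 H3.
have pu := phi_gt0 u; have put := phi_gt0 (u + t).
have E1 : dE 1 u p = (phi u)^-1 by rewrite -[LHS](mulfK (lt0r_neq0 pu)) H2 mul1r.
have E2 : dE 1 (u + t) p = (phi (u + t))^-1.
  by rewrite -[LHS](mulfK (lt0r_neq0 put)) H1 mul1r.
move: H3; rewrite E1 E2 => H3; rewrite /g.
have -> : dE 1 t (e u) = phi u / phi (u + t).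
  by rewrite -H3 mulrC mulfVK// gt_eqF.
by rewrite divfK ?subrr// gt_eqF.
Qed.

Lemma nadic_ge K t : nadic t -> exists (j : int) (l : nat), t = j%:~R / N ^+ (K + l).
Proof.
move=> [j [l ->]]; exists (j * (n ^ K)%N%:Z), l.
rewrite rmorphM /= -pmulrn natrX exprD -/N.
by field; rewrite !expf_neq0 ?gt_eqF.
Qed.

(** Additivity determines [A] on the [n]-adic multiples of a small [t0], continuity
    elsewhere. *)
Lemma additive_linear (A : R -> R) : (forall s, `|s| < eta -> {for s, continuous A}) ->
  A 0 = 0 ->
  (forall s t, nadic t -> `|s| < eta -> `|t| < eta -> `|s + t| < eta ->
    A (s + t) = A s + A t) ->
  exists2 t0, 0 < t0 < eta & forall s, `|s| < eta -> A s = A t0 / t0 * s.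
Proof.
move=> cA A0 AD.
have AM t j : nadic t -> `|j%:R * t| < eta -> A (j%:R * t) = j%:R * A t.
  move=> ht; elim: j => [|j IH]; first by rewrite !mul0r A0.
  rewrite -natr1 !mulrDl !mul1r => jt.
  have E1 : `|j%:R * t + t| = (j%:R + 1) * `|t|.
    by rewrite -{2}[t]mul1r -mulrDl normrM ger0_norm// addr_ge0.
  have j0 : 0 <= j%:R * `|t| by rewrite mulr_ge0.
  have t0 := normr_ge0 t.
  have E2 : `|j%:R * t| = j%:R * `|t| by rewrite normrM normr_nat.
  rewrite E1 mulrDl mul1r in jt.
  by rewrite AD ?IH// ?E1 ?E2 ?mulrDl ?mul1r//; lra.
have /seq_limP/(_ _ eta0)[K /(_ K (leqnn _))] := NX_lim0 1.
have p0 k : 0 < 1 / N ^+ k by rewrite divr_gt0// exprn_gt0.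
rewrite subr0 (gtr0_norm (p0 K)) => Ke; exists (1 / N ^+ K); first by rewrite p0.
have hN k : nadic (1 / N ^+ k) by exists 1, k.
set c := A _ / _.
have AK i : A (1 / N ^+ (K + i)) = c / N ^+ (K + i).
  have E1 : 1 / N ^+ K = (n ^ i)%:R * (1 / N ^+ (K + i)).
    by rewrite natrX exprD -/N; field; rewrite !expf_neq0 ?gt_eqF.
  rewrite /c {1}E1 AM//; last by rewrite -E1 (gtr0_norm (p0 K)).
  by rewrite natrX exprD -/N; field; rewrite !expf_neq0 ?gt_eqF.
have An t : nadic t -> `|t| < eta -> A t = c * t.
  move=> ht; have [j [l ->]] := nadic_ge K ht.
  have Apos k : `|k%:R / N ^+ (K + l)| < eta ->
      A (k%:R / N ^+ (K + l)) = c * (k%:R / N ^+ (K + l)).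
    have -> : k%:R / N ^+ (K + l) = k%:R * (1 / N ^+ (K + l)) by rewrite mul1r.
    by move=> H; rewrite AM// AK; field; rewrite !expf_neq0 ?gt_eqF.
  case: j {ht} => k; first exact: Apos.
  rewrite NegzE rmorphN /= -pmulrn mulNr normrN => kt.
  have hk : nadic (k.+1%:R / N ^+ (K + l)) by exists k.+1%:Z, (K + l)%N.
  have := AD (- (k.+1%:R / N ^+ (K + l))) _ hk.
  by rewrite normrN addNr normr0 A0 Apos// => /(_ kt kt eta0); lra.
move=> s se; apply/eqP; rewrite -subr_eq0; apply/eqP.
apply: (@nadic_eq (fun s => A s - c * s) s (eta - `|s|)); first by rewrite subr_gt0.
  apply: continuousB; first exact: cA.
  by apply: continuousM; [exact: cvg_cst|exact: cvg_id].
move=> t ht ts; rewrite An ?subrr//.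
by have := ler_distD s t 0; rewrite !subr0; lra.
Qed.

End Straightening.

(** A primitive of [expR psi] changes by a constant under each short translation, so it is
    an affine function of [f]. *)
Lemma f_C1_origin psi : (\forall y \near p, {for y, continuous psi}) ->
  (\forall y \near p, expR (psi y) = N * G' y * expR (psi (G y))) -> psi p = 0 ->
  exists2 c, 0 < c & \forall y \near p, is_derive (y : R) 1 f (c * expR (psi y)).
Proof.
move=> cpsi psieq psi0.
have [d d0 Hd] := (nearP _ _).1 (filterI cpsi psieq).
have cexp y : `|y - p| <= d / 2 -> {for y, continuous (fun x => expR (psi x))}.
  move=> yd; apply: continuous_comp; last exact: continuous_expR.
  by have [] // := Hd y; lra.
have [|h dh] := @antiderivative R (fun y => expR (psi y)) p (d / 2) _ cexp.
  by lra.
have /continuous_distP/(_ (d / 2)) [|eta eta0 He] := @e_cont 0; first by lra.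
have {}He s : `|s| < eta -> `|e s - p| < d / 2 by move=> se; apply: He; rewrite subr0.
have psi_cont s : `|s| < eta -> {for e s, continuous psi}.
  by move=> /He H; have [] // := Hd (e s); lra.
have psi_eq s : `|s| < eta -> expR (psi (e s)) = N * G' (e s) * expR (psi (e (s / N))).
  by move=> /He H; have [|_ ->] := Hd (e s); [lra|rewrite GE].
have dhe s : `|s| < eta -> is_derive (e s) 1 h (expR (psi (e s))).
  by move=> /He; exact: dh.
pose H s := h (e s).
have between s1 s2 c : `|s1| < eta -> `|s2| < eta ->
    Num.min (e s1) (e s2) <= c <= Num.max (e s1) (e s2) ->
    exists s, [/\ c = e s, Num.min s1 s2 <= s & s <= Num.max s1 s2].
  move=> s1e s2e; wlog s12 : s1 s2 s1e s2e / s1 <= s2.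
    move=> W; have /orP[|] := le_total s1 s2; first exact: W.
    move=> /(W s2 s1 s2e s1e) {}W; rewrite minC maxC => /W[s [-> ? ?]].
    by exists s; rewrite minC maxC; split.
  have := e_le e_lt s12 => e12; rewrite (min_l e12) (max_r e12) min_l// max_r//.
  move=> /andP[c1 c2].
  have c01 : 0 < c < 1 by have := e01 s1; have := e01 s2; lra.
  exists (f c); split; first by rewrite ef.
    by rewrite leNgt; apply/negP => /e_lt; rewrite ef//; lra.
  by rewrite leNgt; apply/negP => /e_lt; rewrite ef//; lra.
have Hshift s1 s2 t : nadic t -> `|s1| < eta -> `|s2| < eta ->
    `|s1 + t| < eta -> `|s2 + t| < eta -> H (s1 + t) - H s1 = H (s2 + t) - H s2.
  move=> ht s1e s2e s1t s2t.
  pose k y := h (E 1 t y) - h y.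
  have kE s : k (e s) = H (s + t) - H s.
    by rewrite /k Ee ?mul1r//; exact: nscale1.
  rewrite -!kE; apply/eqP; rewrite -subr_eq0 -oppr_eq0 opprB; apply/eqP.
  have [c|c _ ->] := @MVT_between R k (fun=> 0) (e s1) (e s2); last by rewrite mul0r.
  move=> /(between _ _ _ s1e s2e)[s [-> sl su]].
  have se : `|s| < eta.
    by move: s1e s2e sl su; rewrite !ltr_norml; case: (leP s1 s2); lra.
  have ste : `|s + t| < eta.
    by move: s1t s2t sl su; rewrite !ltr_norml; case: (leP s1 s2); lra.
  have := dT_local eta0 psi_cont psi_eq psi0 ht se ste => Es.
  have D1 : is_derive (e s) 1 (h \o E 1 t) (expR (psi (e (s + t))) * dE 1 t (e s)).
    apply: is_derive1_comp; last by apply: dE_deriv => //; exact: nscale1.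
    by rewrite Ee ?mul1r//; [exact: dhe|exact: nscale1].
  have -> : (0 : R) = expR (psi (e (s + t))) * dE 1 t (e s) - expR (psi (e s)).
    by rewrite -Es mulrC subrr.
  by apply: (is_deriveB D1); exact: dhe.
pose A s := H s - H 0.
have cA s : `|s| < eta -> {for s, continuous A}.
  move=> se; apply: continuousB; last exact: cvg_cst.
  apply: continuous_comp; first exact: e_cont.
  exact: is_derive_continuous (dhe _ se).
have AD s t : nadic t -> `|s| < eta -> `|t| < eta -> `|s + t| < eta ->
    A (s + t) = A s + A t.
  move=> ht se te ste; have := Hshift s 0 t ht se _ ste.
  by rewrite add0r normr0 /A => /(_ eta0 te); lra.
have [t0 /andP[t00 t0e] HA] := additive_linear eta0 cA (subrr _) AD.
pose c := A t0 / t0; have c0 : 0 < c.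
  rewrite divr_gt0// /A /H.
  have t0n : `|t0| < eta by rewrite gtr0_norm.
  have z0 : `|0 : R| < eta by rewrite normr0.
  have [x|x _ ->] := @MVT_between R h (fun y => expR (psi y)) (e 0) (e t0).
    move=> /(between _ _ _ z0 t0n)[s [-> sl su]]; apply: dhe.
    move: sl su; rewrite (min_l (ltW t00)) (max_r (ltW t00)) => sl su.
    by rewrite ger0_norm//; lra.
  by rewrite mulr_gt0 ?expR_gt0// subr_gt0 e_lt.
exists c^-1; first by rewrite invr_gt0.
have nearf : \forall s \near (0 : R), `|s| < eta.
  by apply/nearP; exists eta => // s; rewrite subr0.
have fE : \forall y \near p, (c^-1 *: (h - cst (H 0))) y = f y.
  apply/near_e; apply: filterS nearf => s se; rewrite fe.
  have := HA s se; rewrite -/c /A /H => E1.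
  rewrite /GRing.scale /= -[RHS](mulKf (lt0r_neq0 c0)); congr (_ * _).
  exact: E1.
have dhn : \forall y \near p, is_derive (y : R) 1 h (expR (psi y)).
  by apply/near_e; apply: filterS nearf.
apply: filterS2 (near_join fE) dhn => y fEy dhy.
apply: near_eq_is_derive fEy _.
have := is_deriveZ c^-1 (is_deriveB dhy (is_derive_cst (H 0) y 1)).
by rewrite subr0.
Qed.

(** The products telescope, so the potential bounds them. *)
Lemma orbit_prod_potential psi d : contracting G p kap d ->
  (forall y, `|y - p| < d -> expR (psi y) = N * G' y * expR (psi (G y))) ->
  forall k y, `|y - p| < d ->
  orbit_prod G (fun y => N * G' y) k y = expR (psi y) * expR (- psi (iter k G y)).
Proof.
move=> ctr psieq; elim=> [|k IH] y yd.
  by rewrite /orbit_prod big_ord0 expRN divff// gt_eqF ?expR_gt0.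
have [_ Gyd] := contracting_ball Gp kap01 ctr yd.
by rewrite orbit_prodS IH// (psieq y yd) iterSr mulrA.
Qed.

(** The derivative [f' = c * expR psi] solves [w = n * G' * (w \o G)], to which the
    bootstrap applies. *)
Lemma Reg_f_origin : Reg om r.+1 f p.
Proof.
have [psi [cpsi psieq psi0]] := potential.
have [c c0 df] := f_C1_origin cpsi psieq psi0.
exists (fun y => c * expR (psi y)) => //.
have cexp : \forall y \near p, {for y, continuous (fun x => expR (psi x))}.
  by apply: filterS cpsi => y cy; apply: continuous_comp cy _; exact: continuous_expR.
have cexpN : \forall y \near p, {for y, continuous (fun x => expR (- psi x))}.
  apply: filterS cpsi => y cy; apply: (continuous_comp (f := fun x => - psi x)).
    exact: continuousN.
  exact: continuous_expR.
apply: (@bootstrap R om nu G G' p kap mo _ Gp kap01 (dG_near 0) (cG' 0) bG' r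
  (fun y => N * G' y) (cst 0)).
- by case: om_dich => [H|[H _]]; [left; apply: H; exact: kap01|right].
- by apply: (RegZ mo); exact: RegG'.
- exact: Reg_cst mo _ _ _.
- exact: RegG'.
- by apply: filterS cexp => y cy; apply: continuousM cy; exact: cvg_cst.
- apply: filterS psieq => y ->; rewrite /= add0r.
  by rewrite mulrCA.
have [d0 d00 ctr0] := contracting_near (dG_near 0) bG'.
have [d1 d10 H1] := (nearP _ _).1 (filterI psieq (filterI
  (continuous_near_bounded cexp) (continuous_near_bounded cexpN))).
pose d := Num.min d0 d1.
have ctr : contracting G p kap d by apply: contracting_le ctr0; rewrite ge_min lexx.
exists ((`|expR (psi p)| + 1) * (`|expR (- psi p)| + 1)).
apply/nearP; exists d => [|y yd k]; first by rewrite lt_min d00.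
have H2 z : `|z - p| < d -> `|z - p| < d1 by rewrite lt_min => /andP[].
rewrite (@orbit_prod_potential psi d ctr)//.
  rewrite normrM; apply: ler_pM => //; first by have [_ [[]]] := H1 _ (H2 _ yd).
  have := iter_ball Gp kap01 k ctr yd => /H2 yk.
  by have [_ [_ []]] := H1 _ yk.
by move=> z /H2 /H1[].
Qed.

(** Every orbit of [G] enters the neighbourhood of [p] where [f] is known to be regular,
    and [f = n * (f \o G)] pulls the regularity back along the orbit. *)
Theorem Reg_f x : 0 < x < 1 -> Reg om r.+1 f x.
Proof.
move=> x01; rewrite -(ef x01); move: (f x) => s {x x01}.
have /(near_e (Reg om r.+1 f)) /nearP[d d0 H] := Reg_near Reg_f_origin.
have /seq_limP/(_ _ d0)[k /(_ k (leqnn _))] := NX_lim0 s.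
move=> /H; elim: k s => [|k IH] s; first by rewrite expr0 divr1.
rewrite exprS invfM mulrA => /IH{IH}; rewrite -GE => rG.
have rGs : Reg om r.+1 G (e s).
  by apply: E_reg => //; [exact: nscaleNV|exact: nadic0].
have rc : Reg om r.+1 (fun y => N * f (G y)) (e s).
  by apply: (RegZ mo); apply: (Reg_comp mo) => //; rewrite (maxn_idPl _).
apply: Reg_eq rc; apply/near_e; apply: filterE => u.
by rewrite GE !fe mulrC divfK ?gt_eqF.
Qed.

End AffineAction.

(** * Derivatives relative to the closed and the open interval *)

Section RelativeDerivative.
Context {R : realType}.
Implicit Types (D : set R) (g om : R -> R) (x y : R).

Lemma within_continuous_distP D g : {within D, continuous g} <->
  forall x, D x -> forall eps, 0 < eps -> exists2 d, 0 < d &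
    forall y, D y -> `|y - x| < d -> `|g y - g x| < eps.
Proof.
rewrite subspace_continuousP; split=> H x Dx.
  move=> eps eps0; move/cvgrPdist_lt/(_ _ eps0) : (H x Dx).
  rewrite near_withinE => /nearP[d d0 Hd]; exists d => // y Dy yx.
  by rewrite distrC; exact: Hd.
apply/cvgrPdist_lt => eps /(H x Dx)[d d0 Hd].
rewrite near_withinE; apply/nearP; exists d => // y yx Dy.
by rewrite distrC; exact: Hd.
Qed.

Lemma derivable1_in_distP D g x : derivable1_in D g x ->
  forall eps, 0 < eps -> exists2 d, 0 < d & forall y, D y -> `|y - x| < d ->
    `|g y - g x - derive1_in D g x * (y - x)| <= eps * `|y - x|.
Proof.
move=> dg eps eps0.
move/cvgrPdist_le/(_ _ eps0) : (dg : _ --> derive1_in D g x).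
rewrite near_withinE near_withinE => /nearP[d d0 Hd].
exists d => // y Dy yx.
have [->|yx0] := eqVneq y x; first by rewrite !subrr mulr0 subrr normr0 mulr0.
have := Hd y yx yx0 Dy; rewrite /diff_quot => Hy.
have yx1 : y - x != 0 by rewrite subr_eq0.
have -> : g y - g x - derive1_in D g x * (y - x) =
  - (derive1_in D g x - (g y - g x) / (y - x)) * (y - x) by field.
by rewrite normrM normrN ler_wpM2r.
Qed.

Lemma derivable1_in_continuous D g x : derivable1_in D g x ->
  forall eps, 0 < eps -> exists2 d, 0 < d &
    forall y, D y -> `|y - x| < d -> `|g y - g x| < eps.
Proof.
move=> /derivable1_in_distP/(_ 1 ltr01)[d d0 H] eps eps0.
set c := derive1_in D g x in H; have c0 := normr_ge0 c.
exists (Num.min d (eps / (`|c| + 2))).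
  by rewrite lt_min d0 divr_gt0//; lra.
move=> y Dy; rewrite lt_min => /andP[yd ye].
have := H y Dy yd; rewrite mul1r => Hy.
have cy : `|c * (y - x)| = `|c| * `|y - x| by rewrite normrM.
have := ler_normD (g y - g x - c * (y - x)) (c * (y - x)); rewrite subrK cy.
move: ye; rewrite ltr_pdivlMr; last by lra.
have := normr_ge0 (y - x); nra.
Qed.

Lemma derivable1_in_interior D g x : nbhs x D -> derivable1_in D g x ->
  is_derive x 1 g (derive1_in D g x).
Proof.
move=> /nearP[d0 d00 HD] /derivable1_in_distP dg; apply/is_derive_distP => eps.
move=> /dg[d d_gt0 H]; exists (Num.min d0 d); first by rewrite lt_min d00.
by move=> y; rewrite lt_min => /andP[/HD Dy]; exact: H.
Qed.

Let I01 : set R := `[0, 1].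

Lemma I01P x : I01 x <-> 0 <= x <= 1.
Proof. by rewrite /I01 /= in_itv. Qed.

Lemma I01_interior x : 0 < x < 1 -> nbhs x I01.
Proof.
move=> x01; apply/nearP; exists (Num.min x (1 - x)); first by rewrite lt_min; lra.
by move=> y; rewrite lt_min !ltr_norml => H; apply/I01P; lra.
Qed.

Lemma ball01 x : 0 < x < 1 -> \forall y \near x, 0 < y < 1.
Proof.
move=> x01; apply/nearP; exists (Num.min x (1 - x)); first by rewrite lt_min; lra.
by move=> y; rewrite lt_min !ltr_norml => H; lra.
Qed.

Lemma is_C_derive r g k x : is_C I01 r g -> (k < r)%N -> 0 < x < 1 ->
  is_derive x 1 (derive1n_in I01 k g) (derive1n_in I01 k.+1 g x).
Proof.
move=> [dg _] kr x01; apply: derivable1_in_interior; first exact: I01_interior.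
by apply: dg => //; apply/I01P; lra.
Qed.

Lemma is_C_omega_Reg r om g x : is_C_omega I01 r om g -> 0 < x < 1 -> Reg om r g x.
Proof.
move=> [Cg [C C0 og]].
suff H j y : (j <= r)%N -> 0 < y < 1 -> Reg om j (derive1n_in I01 (r - j) g) y.
  by move=> x01; have := H r x (leqnn _) x01; rewrite subnn.
elim: j y => [|j IH] y jr y01 /=.
  rewrite subn0; split.
    apply: filterS (ball01 y01) => z z01; apply/continuous_distP => eps eps0.
    have [_ /within_continuous_distP/(_ z _ _ eps0)] := Cg.
    case; first by apply/I01P; lra.
    move=> d d0 H; have [d' d'0 H'] := (nearP _ _).1 (I01_interior z01).
    exists (Num.min d d'); first by rewrite lt_min d0.
    by move=> u; rewrite lt_min => /andP[ud /H' Du]; exact: H.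
  exists C; first exact: ltW.
  apply: filterS (near2_diag (I01_interior y01)) => -[u v] /= [Du Dv].
  exact: og.
have rj : (r - j.+1).+1 = (r - j)%N by rewrite subnSK.
exists (derive1n_in I01 (r - j) g); last by apply: IH => //; exact: ltnW.
apply: filterS (ball01 y01) => z z01; rewrite -rj.
apply: (is_C_derive Cg) => //.
by rewrite ltn_subrL /=; case: (r) jr.
Qed.

(** The mean value theorem needs the derivative in [(0, 1)] only, and continuity of the
    derivative at [1] relative to [[0, 1]]. *)
Lemma is_C_strict_deriv1 r g : is_C I01 r.+1 g ->
  strict_deriv g 1 (derive1_in I01 g 1).
Proof.
move=> Cg eps eps0; pose g1 := derive1n_in I01 1 g.
have one : I01 1 by apply/I01P; rewrite ler01 lexx.
have [d d0 H] : exists2 d, 0 < d &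
    forall y, I01 y -> `|y - 1| < d -> `|g1 y - g1 1| < eps.
  case: r Cg => [|r] [dg cg].
    by move/within_continuous_distP : cg => /(_ 1 one _ eps0).
  by apply: derivable1_in_continuous => //; exact: (dg 1%N).
exists d => // u v u01 v01 ud vd.
have inI c : Num.min u v <= c <= Num.max u v -> 0 < c < 1.
  by move: u01 v01; case: (leP u v); lra.
have [c /inI c01|c cuv ->] := @MVT_between R g g1 u v.
  exact: (is_C_derive (k := 0%N) Cg).
rewrite -mulrBl normrM ler_wpM2r// ltW// -/(g1 1) H//.
  by apply/I01P; have := inI _ cuv; lra.
by move: ud vd cuv; rewrite !ltr_norml; case: (leP u v); lra.
Qed.

Lemma Reg_is_C_omega_loc r om f : (forall t, 0 <= t -> 0 <= om t) ->
  (forall x, 0 < x < 1 -> Reg om r f x) ->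
  is_C_omega_loc `]0, 1[ r om f.
Proof.
move=> om0; set D := (X in is_C_omega_loc X) => H.
have DP x : D x <-> 0 < x < 1 by rewrite /D /= in_itv.
have oD : open D by exact: itv_open.
have K k x : (k <= r)%N -> 0 < x < 1 -> Reg om (r - k) (derive1n_in D k f) x.
  elim: k x => [|k IH] x kr x01; first by rewrite subn0; exact: H.
  have := IH x (ltnW kr) x01; rewrite -(subnSK kr) => /Reg_derive1[_].
  apply: Reg_eq; apply: filterS (ball01 x01) => y y01.
  by have [_ <-] := derive1_in_open (derive1n_in D k f) oD ((DP y).2 y01).
split; last first.
  move=> x /DP x01; have := K r x (leqnn _) x01; rewrite subnn => -[_ [C C0]].
  move=> /near2P[d d0 Hd]; exists [set y | `|y - x| < d]; first by apply/nearP; exists d.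
  exists (C + 1); first by lra.
  move=> y z [/DP y01 yd] [/DP z01 zd]; apply: le_trans (Hd _ _ yd zd) _ => /=.
  by rewrite ler_wpM2r ?om0// lerDl.
split.
  move=> k x kr /DP x01; apply/(derive1_in_open _ oD ((DP x).2 x01)).1.
  have := K k x (ltnW kr) x01; rewrite -(subnSK kr) => -[g' dg _].
  by case: (nbhs_singleton dg).
apply/within_continuous_distP => x /DP x01 eps eps0.
have := K r x (leqnn _) x01; rewrite subnn => -[/nbhs_singleton cg _].
move/continuous_distP : cg => /(_ _ eps0)[d d0 Hd].
by exists d => // y _; exact: Hd.
Qed.

End RelativeDerivative.

(** * Moduli flatter than the identity *)

Section FlatModulus.
Context {R : realType}.
Implicit Types (g om nu : R -> R) (x y h : R).

(** A modulus dominated by the identity at suitable scales: subdividing an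
    interval at such a scale bounds the total variation by an arbitrarily small
    multiple of the length. *)
Lemma flat_modulus_constant om nu g :
  (forall t, 0 < t < 1 -> nu t < 1) -> (forall t, 0 <= t -> 0 <= om t) ->
  (forall x t, 0 <= x <= 1 -> 0 <= t -> om (t * x) <= nu t * om x) ->
  (forall C, 0 < C -> exists2 t, 0 < t <= 1 & C * om t < t) ->
  omega_continuous om `[0, 1] g ->
  forall x y, 0 <= x <= 1 -> 0 <= y <= 1 -> g x = g y.
Proof.
move=> nu1 om0 omnu flat [C C0 gC] x y.
wlog xy : x y / x < y.
  move=> H; have [xy|yx|->//] := ltgtP x y; first exact: H.
  by move=> x01 y01; apply/esym; exact: H.
move=> x01 y01; apply/eqP; rewrite -subr_eq0 -normr_le0.
apply/ler_addgt0Pr => eps eps0; rewrite add0r.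
(* The constant is such that about [1 / t] steps, each of variation at most
   [C * om t], add up to less than [eps]. *)
have [|t /andP[t0 t1] tC] := flat (2 * C / eps).
  by rewrite divr_gt0// mulr_gt0.
pose M := (Num.truncn ((y - x) / t)).+1; pose l := (y - x) / M%:R.
have M0 : 0 < M%:R :> R by rewrite ltr0n.
have l0 : 0 < l by rewrite divr_gt0// subr_gt0.
have lt : l < t.
  rewrite /l ltr_pdivrMr// mulrC -ltr_pdivrMr//; exact: truncnS_gt.
have oml : om l <= om t.
  rewrite -(divfK (lt0r_neq0 t0) l); apply: le_trans (omnu _ _ _ _) _.
  - by rewrite ltW.
  - by rewrite divr_ge0// ltW.
  rewrite -[leRHS]mul1r ler_wpM2r ?om0 ?(ltW t0)// ltW// nu1//.
  by rewrite divr_gt0//= ltr_pdivrMr// mul1r.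
have step k : (k <= M)%N -> `|g x - g (x + k%:R * l)| <= k%:R * (C * om t).
  elim: k => [|k IH] kM; first by rewrite !mul0r addr0 subrr normr0.
  have inI j : (j <= M)%N -> (`[0, 1]%classic : set R) (x + j%:R * l).
    move=> jM; rewrite /= in_itv /=.
    have : j%:R * l <= M%:R * l by rewrite ler_pM2r// ler_nat.
    have : M%:R * l = y - x by rewrite /l mulrC divfK ?gt_eqF.
    have : 0 <= j%:R * l by rewrite mulr_ge0// ltW.
    by move=> *; lra.
  apply: le_trans (ler_distD (g (x + k%:R * l)) _ _) _.
  have -> : k.+1%:R * (C * om t) = k%:R * (C * om t) + C * om t.
    by rewrite -natr1; ring.
  apply: lerD; first exact: IH (ltnW kM).
  apply: le_trans (gC _ _ (inI _ (ltnW kM)) (inI _ kM)) _.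
  rewrite ler_pM2l//.
  have -> : x + k%:R * l - (x + k.+1%:R * l) = - l by rewrite -natr1; ring.
  by rewrite normrN gtr0_norm.
have := step M (leqnn _).
have -> : x + M%:R * l = y by rewrite /l [M%:R * _]mulrC divfK ?gt_eqF//; ring.
move=> /le_trans; apply.
have Mt : M%:R * t <= 2.
  have : (Num.truncn ((y - x) / t))%:R <= (y - x) / t.
    by rewrite truncn_le divr_ge0// ltW// subr_gt0.
  rewrite ler_pdivlMr//.
  have -> : M%:R * t = (Num.truncn ((y - x) / t))%:R * t + t.
    by rewrite /M -natr1; ring.
  by lra.
move: tC; rewrite mulrAC ltr_pdivrMr// => tC.
have : M%:R * (2 * C * om t) <= M%:R * (t * eps) by rewrite ler_pM2l// ltW.
have -> : M%:R * (t * eps) = (M%:R * t) * eps by ring.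
have : (M%:R * t) * eps <= 2 * eps by rewrite ler_pM2r.
have -> : M%:R * (2 * C * om t) = 2 * (M%:R * (C * om t)) by ring.
by lra.
Qed.

(** Agreement on [(0, 1)] with a polynomial of degree at most [r], expressed through
    derivatives. *)
Fixpoint poly_like r g : Prop := match r with
  | 0 => exists c, forall y, 0 < y < 1 -> g y = c
  | r'.+1 => exists2 g' : R -> R, forall y, 0 < y < 1 -> is_derive y 1 g (g' y)
                                & poly_like r' g'
  end.

Fixpoint findiff h k g x : R := match k with
  | 0 => g x
  | k'.+1 => findiff h k' g (x + h) - findiff h k' g x
  end.

Lemma is_derive_shift1 g x h c : is_derive (x + h) 1 g c ->
  is_derive x 1 (fun y => g (y + h)) c.
Proof.
move=> /is_derive_distP dg; apply/is_derive_distP => eps /dg[d d0 H].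
exists d => // y yx; have := H (y + h).
by have -> : y + h - (x + h) = y - x by [ring]; exact.
Qed.

Lemma is_derive_findiff h k g (g' : R -> R) x : 0 < h -> 0 < x -> x + k%:R * h < 1 ->
  (forall y, 0 < y < 1 -> is_derive y 1 g (g' y)) ->
  is_derive x 1 (findiff h k g) (findiff h k g' x).
Proof.
move=> h0 + + dg; elim: k x => [|k IH] x x0 /=.
  by rewrite mul0r addr0 => x1; apply: dg; rewrite x0.
rewrite -natr1 mulrDl mul1r => x1.
have xh : x + k%:R * h < 1 by lra.
apply: is_deriveB (IH _ x0 xh); apply: is_derive_shift1; apply: IH; lra.
Qed.

(** Finite differences commute with differentiation, and a map with zero derivative has
    zero increments. *)
Lemma findiff_poly_like h r g x : 0 < h -> poly_like r g -> 0 < x ->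
  x + r.+1%:R * h < 1 -> findiff h r.+1 g x = 0.
Proof.
move=> h0; elim: r g x => [|r IH] g x /=.
  move=> [c gc] x0; rewrite mul1r => x1; rewrite !gc ?subrr//; lra.
move=> [g' dg pg'] x0 x1.
rewrite -/(findiff h r.+1 g (x + h)) -/(findiff h r.+1 g x).
have hr : r.+2%:R * h = r.+1%:R * h + h by rewrite -natr1 mulrDl mul1r.
have [c|c cx ->] := @MVT_between R (findiff h r.+1 g) (fun=> 0) x (x + h); last by rewrite mul0r.
rewrite min_l ?max_r; [|lra|lra] => cx.
have <- : findiff h r.+1 g' c = 0 by apply: IH => //; lra.
by apply: is_derive_findiff => //; lra.
Qed.

(** The iterates [T j] tend to [1] away from the endpoint [0], while [T j] keeps the value
    [e 0] at the moving point [e (- j)]. Their differences of order [r.+1] along an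
    arithmetic progression starting there have a nonzero limit, but they vanish for
    polynomials of degree at most [r]. *)
Lemma translations_not_poly_like (e f : R -> R) (T : nat -> R -> R) r :
  (forall s t, s < t -> e s < e t) -> (forall s, 0 < e s < 1) ->
  (forall x, 0 < x < 1 -> e (f x) = x) ->
  (forall j s, T j (e s) = e (s + j%:R)) -> (forall j, poly_like r (T j)) -> False.
Proof.
move=> e_lt e01 ef Te pT.
have e_le s t : s <= t -> e s <= e t := @e_le R e e_lt s t.
have le_e s t : e s <= e t -> s <= t.
  by move=> est; rewrite leNgt; apply/negP => /e_lt; lra.
have e_to1' x : x < 1 -> exists s, x < e s.
  move=> x1; exists (f ((Num.max x 0 + 1) / 2)).
  have m1 : x <= Num.max x 0 by rewrite le_max lexx.
  have m0 : 0 <= Num.max x 0 by rewrite le_max lexx orbT.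
  have m2 : Num.max x 0 < 1 by rewrite gt_max x1 ltr01.
  by rewrite ef; lra.
(* The nodes [e (- j) + i * h], for [i <= r.+1], stay below [1] once [e (- j) < h]. *)
pose h : R := (r.+2%:R)^-1.
have r2 : 0 < r.+2%:R :> R by rewrite ltr0n.
have h0 : 0 < h by rewrite invr_gt0.
have rh : r.+1%:R * h + h = 1.
  by rewrite -{2}[h]mul1r -mulrDl natr1 mulfV// gt_eqF.
have h1 : h < 1 by have : 0 < r.+1%:R * h by [rewrite mulr_gt0// ltr0n]; lra.
have [J HJ] : exists J, forall j, (J <= j)%N -> e (- j%:R) < h.
  have [J HJ] := tends_infty_nat (- f (h / 2)); exists J => j /HJ jf.
  have : e (- j%:R) <= e (f (h / 2)) by apply: e_le; lra.
  by rewrite ef; lra.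
have lim1 k i : (0 < i)%N -> (i + k <= r.+1)%N ->
    (fun j => findiff h k (T j) (e (- j%:R) + i%:R * h)) @ \oo --> ((k == 0%N)%:R : R).
  elim: k i => [|k IH] i i0 ik.
    apply/seq_limP => eps eps0 /=.
    have /(e_lim1 e_lt e01 e_to1') : tends_infty (fun j => f h + j%:R).
      move=> A; have [K HK] := tends_infty_nat (A - f h).
      by exists K => j /HK; lra.
    move=> /seq_limP/(_ _ eps0)[K HK]; exists (maxn J K) => j.
    rewrite geq_max => /andP[/HJ jh /HK] /=.
    have ej := e01 (- j%:R).
    have ih : h <= i%:R * h by rewrite -[leLHS]mul1r ler_pM2r// ler1n.
    have ih1 : i%:R * h <= r.+1%:R * h by rewrite ler_pM2r// ler_nat -(addn0 i).
    set z := e (- j%:R) + i%:R * h.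
    have z01 : 0 < z < 1 by rewrite /z; lra.
    have : f h <= f z by apply: le_e; rewrite !ef /z; lra.
    move=> fz; have : e (f h + j%:R) <= e (f z + j%:R) by apply: e_le; rewrite lerD2r.
    have := e01 (f z + j%:R); rewrite -Te ef// !ltr_norml.
    by lra.
  have E : (fun j => findiff h k.+1 (T j) (e (- j%:R) + i%:R * h)) =
      (fun j => findiff h k (T j) (e (- j%:R) + i.+1%:R * h) -
                findiff h k (T j) (e (- j%:R) + i%:R * h)).
    by apply/funext => j /=; rewrite -natr1 mulrDl mul1r addrA.
  rewrite E (_ : (k.+1 == 0%N)%:R = (k == 0%N)%:R - (k == 0%N)%:R); last by rewrite subrr.
  apply: cvgB; apply: IH => //.
    by rewrite addSnnS.
  by rewrite (leq_trans _ ik)// addnS.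
(* The [k]-th difference of the constant [1] is [1] for [k = 0] and [0] otherwise; at the
   moving point the value deviates from it by [1 - e 0] at every order, up to sign. *)
have limT k : (k <= r.+1)%N -> exists2 u : R,
    (fun j => findiff h k (T j) (e (- j%:R))) @ \oo --> u &
    `|u - (k == 0%N)%:R| = 1 - e 0.
  elim: k => [|k IH] kr /=.
    exists (e 0); last by rewrite ltr0_norm ?opprB// subr_lt0; case/andP: (e01 0).
    by under eq_fun do rewrite Te addNr; exact: cvg_cst.
  have [u ulim uE] := IH (ltnW kr); exists ((k == 0%N)%:R - u).
    apply: cvgB ulim; have := lim1 k 1%N isT kr.
    by under eq_fun do rewrite mul1r.
  by rewrite subr0 distrC.
have [u ulim] := limT r.+1 (leqnn _); rewrite subr0.
have -> : u = 0; last by rewrite normr0; have := e01 0; lra.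
apply: seq_lim_unique ulim _; apply/seq_limP => eps eps0; exists J => j /HJ jh.
rewrite findiff_poly_like ?subrr ?normr0//; first by case/andP: (e01 (- j%:R)).
by lra.
Qed.

End FlatModulus.

(** * From the action to the regularity of the conjugacy *)

Section Conjugacy.
Context {R : realType}.
Implicit Types (g f e om nu : R -> R) (a s t x y mu : R).

Lemma is_C_omega_poly_like r om g : is_C_omega `[0, 1] r om g ->
  (forall x y, 0 <= x <= 1 -> 0 <= y <= 1 ->
    derive1n_in `[0, 1] r g x = derive1n_in `[0, 1] r g y) -> poly_like r g.
Proof.
move=> [Cg _] cst_g.
suff H j : (j <= r)%N -> poly_like j (derive1n_in `[0, 1] (r - j) g).
  by have := H r (leqnn _); rewrite subnn.
elim: j => [|j IH] jr /=.
  rewrite subn0; exists (derive1n_in `[0, 1] r g 0) => y y01.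
  by apply: cst_g; rewrite ?lexx ?ler01//; lra.
exists (derive1n_in `[0, 1] (r - j) g); last by apply: IH; exact: ltnW.
move=> y y01; rewrite -(subnSK jr); apply: (is_C_derive Cg) => //.
by rewrite ltn_subrL /=; case: (r) jr.
Qed.

Lemma RegN om r g x : Reg om r g x -> Reg om r (fun y => - g y) x.
Proof.
elim: r g => [|r IH] g /=.
  move=> [cg [C C0 og]]; split.
    by apply: filterS cg => y; exact: continuousN.
  by exists C => //; apply: filterS og => -[y z] /=; rewrite -opprD normrN.
move=> [g' dg /IH rg]; exists (fun y => - g' y) => //.
by apply: filterS dg => y; exact: is_deriveN.
Qed.

Section Oriented.
Variables (n r : nat) (om nu e f : R -> R) (E : R -> R -> R -> R).
Hypothesis n_ge2 : (2 <= n)%N.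
Hypothesis om0 : forall t, 0 <= t -> 0 <= om t.
Hypothesis nu0 : forall t, 0 <= t -> 0 <= nu t.
Hypothesis nu_le : forall s t, 0 <= s -> s <= t -> nu s <= nu t.
Hypothesis omM : forall x t, 0 <= x <= 1 -> 0 <= t -> om (t * x) <= nu t * om x.
Hypothesis om_dich : (forall t, 0 < t < 1 -> nu t < 1) \/
  (forall t, 0 <= t -> om t = 1) /\ (0 < r)%N.
Hypothesis e_lt : forall s t, s < t -> e s < e t.
Hypothesis e01 : forall s, 0 < e s < 1.
Hypothesis e_cont : forall s, {for s, continuous e}.
Hypothesis fe : forall s, f (e s) = s.
Hypothesis ef : forall x, 0 < x < 1 -> e (f x) = x.
Hypothesis Ee : forall a t s, nscale n a -> nadic n t -> E a t (e s) = e (a * s + t).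
Hypothesis E_C : forall a t, nscale n a -> nadic n t ->
  is_C_omega `[0, 1] r.+1 om (E a t).

(** If no such constant existed, the [r.+1]-st derivatives of all group elements would be
    constant, which the iterates of the unit translation exclude. *)
Lemma om_linear : exists2 C, 0 <= C & forall t, 0 <= t <= 1 -> t <= C * om t.
Proof.
have [hn|[om1 _]] := om_dich; last first.
  by exists 1 => // t /andP[t0 t1]; rewrite om1// mul1r.
apply: contrapT => nlin.
have flat C : 0 < C -> exists2 t, 0 < t <= 1 & C * om t < t.
  move=> C0; apply: contrapT => H; apply: nlin; exists C; first exact: ltW.
  move=> t /andP[t0 t1]; rewrite leNgt; apply/negP => Ct; apply: H; exists t => //.
  rewrite t1 andbT; apply: le_lt_trans Ct.
  by rewrite mulr_ge0 ?om0// ltW.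
have h1 := @nscale1 R n; have hj := @nadic_nat R n.
apply: (@translations_not_poly_like R e f (fun j => E 1 j%:R) r.+1) => //.
  by move=> j s; rewrite Ee// mul1r.
move=> j; have EC := E_C h1 (hj j); apply: is_C_omega_poly_like (EC) _.
by move=> x y x01 y01; case: EC => _ oE; exact: (flat_modulus_constant hn om0 omM flat oE).
Qed.

Lemma Reg_oriented x : 0 < x < 1 -> Reg om r.+1 f x.
Proof.
have mo : modulus om nu by split => //; exact: om_linear.
apply: (@Reg_f R n r om nu e f E) => //.
  by move=> a t y ha ht; apply: is_C_omega_Reg; exact: E_C.
move=> a t ha ht; have [CE _] := E_C ha ht.
by exists (derive1_in `[0, 1] (E a t) 1); exact: is_C_strict_deriv1 CE.
Qed.

End Oriented.

Lemma Gamma_affine n mu a t : (2 <= n)%N -> nscale n a -> nadic n t ->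
  Gamma_A n mu (fun x => a * x + t).
Proof.
move=> n2 ha ht M [[_ Mid Mcomp Minv] Mgen].
have N0 : n%:R != 0 :> R by rewrite pnatr_eq0; case: n n2 {ha ht Mgen}.
have M1 : M (fun x => x + 1) by apply: Mgen; left; left.
have Mn : M (fun x => n%:R * x) by apply: Mgen; left; right.
have MN1 : M (fun x => x - 1).
  by apply: Minv M1 _ _ => x; rewrite ?addrK ?subrK.
have MnV : M (fun x => n%:R^-1 * x).
  by apply: Minv Mn _ _ => x; rewrite ?mulKf ?mulVKf.
have Mshift (k : nat) : M (fun x => x + k%:R) /\ M (fun x => x - k%:R).
  elim: k => [|k [IH1 IH2]].
    split; [rewrite (_ : (fun x => _) = id)//|rewrite (_ : (fun x => _) = id)//];
    by apply/funext => x /=; rewrite ?addr0 ?subr0.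
  split.
    rewrite (_ : (fun x => _) = (fun x => x + 1) \o (fun x => x + k%:R)); first exact: Mcomp.
    by apply/funext => x /=; rewrite -natr1 addrA.
  rewrite (_ : (fun x => _) = (fun x => x - 1) \o (fun x => x - k%:R)); first exact: Mcomp.
  by apply/funext => x /=; rewrite -natr1 opprD addrA.
have Mscale (k : nat) : M (fun x => n%:R ^+ k * x) /\ M (fun x => (n%:R ^+ k)^-1 * x).
  elim: k => [|k [IH1 IH2]].
    split; [rewrite (_ : (fun x => _) = id)//|rewrite (_ : (fun x => _) = id)//];
    by apply/funext => x /=; rewrite ?expr0 ?invr1 mul1r.
  split.
    rewrite (_ : (fun x => _) = (fun x => n%:R * x) \o (fun x => n%:R ^+ k * x)).
      exact: Mcomp.
    by apply/funext => x /=; rewrite exprS mulrA.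
  rewrite (_ : (fun x => _) = (fun x => n%:R^-1 * x) \o (fun x => (n%:R ^+ k)^-1 * x)).
    exact: Mcomp.
  by apply/funext => x /=; rewrite exprS invfM mulrA.
have Ma : M (fun x => a * x).
  by case: ha => k [->|->]; have [H1 H2] := Mscale k; [exact: H1|exact: H2].
have Mt : M (fun x => x + t).
  case: ht => j [l ->]; have [Ml MlV] := Mscale l.
  have Mj : M (fun x => x + j%:~R).
    case: j => k; first by have [H1 _] := Mshift k; exact: H1.
    by rewrite NegzE rmorphN; have [_ H2] := Mshift k.+1; exact: H2.
  rewrite (_ : (fun x => _) = (fun x => (n%:R ^+ l)^-1 * x) \o
     ((fun x => x + j%:~R) \o (fun x => n%:R ^+ l * x))).
    by apply: (Mcomp) => //; exact: Mcomp.
  by apply/funext => x /=; field; rewrite expf_neq0.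
rewrite (_ : (fun x => _) = (fun x => x + t) \o (fun x => a * x))//.
exact: Mcomp.
Qed.

(** An injective continuous self-map of [[0, 1]] is monotone, so interior points
    stay between the images of the endpoints. *)
Lemma interior_stable g x : set_bij `[0, 1] `[0, 1] g ->
  {within `[0, 1], continuous g} -> 0 < x < 1 -> 0 < g x < 1.
Proof.
move=> [gf gi _] cg x01.
have I0 : (0 : R) \in `[0, 1] by rewrite in_itv /= lexx ler01.
have I1 : (1 : R) \in `[0, 1] by rewrite in_itv /= lexx ler01.
have Ix : x \in `[0, 1] by rewrite in_itv /=; lra.
have g0 : 0 <= g 0 <= 1 by have := gf 0 I0; rewrite /= in_itv.
have g1 : 0 <= g 1 <= 1 by have := gf 1 I1; rewrite /= in_itv.
case/andP: (x01) => x0 x1.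
have [|mono|mono] := itv_continuous_inj_mono cg.
- by move=> y z yI zI; apply: gi; rewrite inE.
- have := mono 0 x I0 Ix x0; have := mono x 1 Ix I1 x1; lra.
- have := mono x 0 Ix I0 x0; have := mono 1 x I1 Ix x1; lra.
Qed.

(** The Hölder classes and the classes [C^(r + omega)] are treated alike: either the
    modulus decays geometrically under contractions, or it is constant and there is one
    more derivative to work with. A decreasing conjugacy is replaced by its opposite. *)
Theorem conjugacy_regularity n r mu om nu phi f : (2 <= n)%N ->
  (forall t, 0 <= t -> 0 <= om t) -> (forall t, 0 <= t -> 0 <= nu t) ->
  (forall s t, 0 <= s -> s <= t -> nu s <= nu t) ->
  (forall x t, 0 <= x <= 1 -> 0 <= t -> om (t * x) <= nu t * om x) ->
  (forall t, 0 < t < 1 -> nu t < 1) \/ (forall t, 0 <= t -> om t = 1) /\ (0 < r)%N ->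
  is_action (Gamma_A n mu) (is_C_omega `[0, 1] r.+1 om) phi ->
  conjugates_to_standard (Gamma_A n mu) phi f ->
  is_C_omega_loc `]0, 1[ r.+1 om f.
Proof.
move=> n2 om0 nu0 nu_le omM om_dich [phiD _] [[fb _ [e [e_fun fK eK ce]]] fphi].
apply: Reg_is_C_omega_loc => // x x01.
have e01 s : 0 < e s < 1 by have := e_fun s I; rewrite /= in_itv.
have fe s : f (e s) = s by apply: eK; rewrite inE.
have ef y : 0 < y < 1 -> e (f y) = y by move=> y01; apply: fK; rewrite inE /= in_itv.
have e_cont s : {for s, continuous e}.
  apply/continuous_distP => eps eps0.
  have /within_continuous_distP/(_ s I _ eps0)[d d0 H] := ce.
  by exists d => // y; exact: H.
have phiE a t s : nscale n a -> nadic n t ->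
    phi (fun x => a * x + t) (e s) = e (a * s + t).
  move=> ha ht; have hG := @Gamma_affine n mu a t n2 ha ht.
  have [gb [[[dg _] _] _]] := phiD _ hG.
  have es := e01 s.
  have /interior_stable : {within `[0, 1], continuous (phi (fun x => a * x + t))}.
    apply/within_continuous_distP => y Dy; apply: derivable1_in_continuous.
    exact: (dg 0%N).
  move=> /(_ _ gb es) pe; rewrite -(ef _ pe) fphi//; first by rewrite fe.
have phiC a t : nscale n a -> nadic n t ->
    is_C_omega `[0, 1] r.+1 om (phi (fun x => a * x + t)).
  by move=> ha ht; have [_ []] := phiD _ (@Gamma_affine n mu a t n2 ha ht).
have [||e_lt|e_gt] := @itv_continuous_inj_mono R e `]-oo, +oo[.
- by apply: continuous_in_subspaceT => s _; exact: e_cont.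
- by move=> s t _ _ est; rewrite -(fe s) est fe.
- apply: (@Reg_oriented n r om nu e f (fun a t => phi (fun x => a * x + t))) => //.
  by move=> s t st; apply: e_lt; rewrite ?in_itv.
have := @Reg_oriented n r om nu (fun s => e (- s)) (fun y => - f y)
  (fun a t => phi (fun x => a * x + - t)).
move=> H; have := RegN (H _ _ _ _ _ _ _ _ _ _ _ _ _ x x01).
rewrite (_ : (fun y => - - f y) = f); last by apply/funext => y; rewrite opprK.
apply => //.
- by move=> s t st; apply: e_gt; rewrite ?in_itv// ltrN2.
- move=> s; apply: (continuous_comp (f := -%R)); last exact: e_cont.
  exact: continuousN.
- by move=> s; rewrite fe opprK.
- by move=> y y01; rewrite opprK ef.
- move=> a t s ha ht; rewrite phiE//; last exact: nadicN.
  by congr e; rewrite mulrN opprD.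
- by move=> a t ha ht; apply: phiC => //; exact: nadicN.
Qed.

End Conjugacy.

Theorem proposition4p1 (R : realType) (n : nat) (mu : R)
    (n_ge2 : (2 <= n)%N) (mu_irr : irrational mu) :
  (forall (alpha : R) (phi : (R -> R) -> R -> R) (f : R -> R),
     0 < alpha ->
     is_action (Gamma_A n mu) (is_C_real `[0, 1] (1 + alpha)) phi ->
     conjugates_to_standard (Gamma_A n mu) phi f ->
     is_C_real_loc `]0, 1[ (1 + alpha) f) /\
  (forall (r : nat) (omega : R -> R) (phi : (R -> R) -> R -> R) (f : R -> R),
     (1 <= r)%N -> admissible_modulus omega ->
     is_action (Gamma_A n mu) (is_C_omega `[0, 1] r omega) phi ->
     conjugates_to_standard (Gamma_A n mu) phi f ->
     is_C_omega_loc `]0, 1[ r omega f).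
Proof.
split=> [alpha phi f alpha0|[//|r] om phi f _ [[[omb _ _] _ _] [nu [nuf nu_le nuf1 omM]]]].
  rewrite /is_C_real /is_C_real_loc; set a := 1 + alpha.
  have a1 : 1 < a by rewrite /a; lra.
  have /andP[ta at1] : (Num.truncn a)%:R <= a < (Num.truncn a).+1%:R.
    by rewrite truncn_le truncnS_gt andbT; lra.
  have tr1 : (0 < Num.truncn a)%N.
    rewrite lt0n; apply/eqP => t0; move: at1; rewrite t0; lra.
  pose b := a - (Num.truncn a)%:R.
  have b0 : 0 <= b by rewrite subr_ge0.
  have [r tE] : exists r, Num.truncn a = r.+1 by exists (Num.truncn a).-1; rewrite prednK.
  have dich : 0 < b \/ b = 0 /\ (0 < r)%N.
    have [bp|bn] := ltP 0 b; [by left|right].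
    have bz : b = 0 by apply/eqP; rewrite eq_le bn b0.
    split=> //; rewrite -ltnS -tE -(ltr_nat R).
    by move: bz a1; rewrite /b; lra.
  rewrite tE; apply: (@conjugacy_regularity R n r mu (holder_modulus a) (holder_modulus a)) => //;
    rewrite /holder_modulus -/b.
  - by move=> t _; exact: powR_ge0.
  - by move=> t _; exact: powR_ge0.
  - by move=> s t s0 st; apply: ge0_ler_powR => //; rewrite nnegrE// (le_trans s0).
  - by move=> x t /andP[x0 _] t0; rewrite powRM.
  case: dich => [bp|[bz r0]]; [left=> t /andP[t0 t1]|right; split => // t _].
    rewrite (_ : 1 = 1 `^ b); last by rewrite powR1.
    apply: gt0_ltr_powR => //.
      by rewrite nnegrE ltW.
    by rewrite nnegrE.
  by rewrite bz powRr0.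
apply: (@conjugacy_regularity R n r mu om nu) => //.
- by move=> t t0; have := omb t; rewrite /= !in_itv /= !andbT; exact.
- by move=> t t0; have := nuf t; rewrite /= !in_itv /= !andbT; exact.
- move=> s t s0 st; apply: nu_le => //; rewrite in_itv /= andbT //.
  exact: le_trans st.
- by left=> t t01; have := nuf1 t; rewrite /= !in_itv /= => /(_ t01)/andP[].
Qed.
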